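(* Let $d\ge2$ be an integer, let $n,n'\ge0$ be integers and $N=\max\{n,n'\}$, and let $p$ be real with $p>2N+d$. For $m=0,1,\ldots$ let $\{Y_l^m:1\le l\le\dim\mathcal H_m^d\}$ be an orthonormal basis of $\mathcal H_m^d$, and for $0\le m\le n$, $1\le l\le\dim\mathcal H_m^d$ define $$S_{n,m,l}^{p,N}(x,t)=N_{n-m}^{(p-2m-d+1)}(t)\,Y_l^m(x)$$ (the superscript $N$ in $S^{p,N}_{n,m,l}$ is a label, not the integer $\max\{n,n'\}$). Then $\{S_{n,m,l}^{p,N}:0\le m\le n,\ 1\le l\le\dim\mathcal H_m^d\}$ is an orthogonal basis of $\mathcal V_n(\mathbb V_0^{d+1},w_p)$, and for $0\le m\le n$, $0\le m'\le n'$, $1\le l\le\dim\mathcal H_m^d$, $1\le l'\le\dim\mathcal H_{m'}^d$, $$\left\langle S_{n,m,l}^{p,N},S_{n',m',l'}^{p,N}\right\rangle_p=\frac{(n-m)!\,(p-n-m-d)!}{(p-2n-d)\,\Gamma(p-d)}\,\delta_{n,n'}\delta_{m,m'}\delta_{l,l'},$$ where $z!$ means $\Gamma(z+1)$.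
   Context: Univariate polynomials: $N_n^{(p)}(x)=(-1)^nx^pe^{1/x}\frac{d^n}{dx^n}\left(x^{-p+2n}e^{-1/x}\right)$, a polynomial of degree at most $n$ in $x$. Spherical harmonics: $\mathcal H_m^d$ is the space of homogeneous polynomials of degree $m$ in $d$ variables that are harmonic on $\mathbb R^d$; orthonormality is with respect to $\frac1{\varpi_d}\int_{\mathbb S^{d-1}}fg\,d\sigma$, where $d\sigma$ is surface measure on the unit sphere $\mathbb S^{d-1}$ and $\varpi_d=\frac{2\pi^{d/2}}{\Gamma(d/2)}$ is its total area. $Y_l^m(x)$ denotes the homogeneous polynomial on $\mathbb R^d$. Surface of the cone: $\mathbb V_0^{d+1}=\{(x,t):\|x\|=t,\ x\in\mathbb R^d,\ 0\le t<\infty\}$, with measure $d\sigma(x,t)$ given by $\int_{\mathbb V_0^{d+1}}f(x,t)\,d\sigma(x,t)=\int_0^\infty t^{d-1}\int_{\mathbb S^{d-1}}f(t\xi,t)\,d\sigma(\xi)\,dt$. Weight $w_p(t)=t^{-p}e^{-1/t}$ and inner product $\langle f,g\rangle_p=b_p\int_{\mathbb V_0^{d+1}}f(x,t)g(x,t)\,t^{-p}e^{-1/t}\,d\sigma(x,t)$ with $b_p=\frac{1}{\varpi_d\,\Gamma(p-d)}$, considered on polynomials in $(x,t)$ modulo the ideal generated by $\|x\|^2-t^2$ (i.e. restrictions of polynomials to $\mathbb V_0^{d+1}$). $\mathcal V_n(\mathbb V_0^{d+1},w_p)$ is the space of (classes of) polynomials of degree at most $n$ orthogonal to all polynomials of degree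 less than $n$ with respect to $\langle\cdot,\cdot\rangle_p$. *)

(* Defs.v *)
From HB Require Import structures.
From mathcomp Require Import all_boot all_order all_algebra.
(* The notations of mpoly clash with those of MathComp-Analysis, and its
   structure [Measure] would hide the one of measure theory if it were
   imported later. *)
From mathcomp Require Import -(notations) mpoly.
From mathcomp Require Import all_classical all_reals all_analysis.
From mathcomp Require Import measurable_realfun.
From mathcomp Require Import ring.

Set Implicit Arguments.
Unset Strict Implicit.
Unset Printing Implicit Defensive.

Import Order.TTheory GRing.Theory Num.Theory.
Import numFieldNormedType.Exports.

Local Open Scope classical_set_scope.
Local Open Scope ring_scope.

Notation "'RR[' R ]_ d" := (d.-tuple (measurableTypeR R))
  (at level 2, d at level 2, format "'RR[' R ]_ d").

Section lebesgue_tuple_step.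
Variables (R : realType) (d : nat).
Variable mu : {sigma_finite_measure set RR[R]_d -> \bar R}.

Definition cons_pair (z : measurableTypeR R * RR[R]_d) : RR[R]_d.+1 :=
  [tuple of z.1 :: z.2].

Lemma measurable_cons_pair : measurable_fun setT cons_pair.
Proof. exact: measurable_cons. Qed.

Definition uncons_pair (t : RR[R]_d.+1) : measurableTypeR R * RR[R]_d :=
  (thead t, [tuple of behead t]).

Lemma measurable_uncons_pair : measurable_fun setT uncons_pair.
Proof.
apply: measurable_fun_pair; first exact: measurable_tnth.
exact: measurable_behead.
Qed.

Lemma cons_pairK : cancel cons_pair uncons_pair.
Proof.
case=> x t; rewrite /uncons_pair /cons_pair/= theadE; congr (_, _).
exact: val_inj.
Qed.

Definition lebesgue_cons : set RR[R]_d.+1 -> \bar R :=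
  pushforward (lebesgue_measure \x mu)%E cons_pair.

Let lebesgue_cons0 : lebesgue_cons set0 = 0%E.
Proof. by rewrite /lebesgue_cons /pushforward preimage_set0 measure0. Qed.

Let lebesgue_cons_ge0 A : (0 <= lebesgue_cons A)%E.
Proof. by rewrite /lebesgue_cons /pushforward; exact: measure_ge0. Qed.

Let lebesgue_cons_sigma_additive : semi_sigma_additive lebesgue_cons.
Proof.
move=> F mF tF mUF; rewrite /lebesgue_cons /pushforward preimage_bigcup.
apply: measure_semi_sigma_additive.
- by move=> n; rewrite -[X in measurable X]setTI; exact: measurable_cons_pair.
- apply/trivIsetP => /= i j _ _ ij; rewrite -preimage_setI.
  by move/trivIsetP : tF => /(_ _ _ _ _ ij) ->//; rewrite preimage_set0.
- rewrite -preimage_bigcup -[X in measurable X]setTI.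
  exact: measurable_cons_pair.
Qed.

HB.instance Definition _ := isMeasure.Build _ _ _ lebesgue_cons
  lebesgue_cons0 lebesgue_cons_ge0 lebesgue_cons_sigma_additive.

Let lebesgue_cons_sigma_finite : sigma_finite setT lebesgue_cons.
Proof.
have /sigma_finiteP[F [TF ndF Foo]] := sigma_finiteT (@lebesgue_measure R).
have /sigma_finiteP[G [TG ndG Goo]] := sigma_finiteT mu.
exists (fun n => uncons_pair @^-1` (F n `*` G n)).
  rewrite -preimage_bigcup; apply/esym/seteqP; split => //= t _.
  have [n _ Fn] : (\bigcup_i F i) (uncons_pair t).1 by rewrite -TF.
  have [k _ Gk] : (\bigcup_i G i) (uncons_pair t).2 by rewrite -TG.
  exists (maxn n k) => //; split.
  - by move: Fn; exact/subsetPset/ndF/leq_maxl.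
  - by move: Gk; exact/subsetPset/ndG/leq_maxr.
move=> n; have [mF Fn] := Foo n; have [mG Gn] := Goo n; split.
  rewrite -[X in measurable X]setTI; apply: measurable_uncons_pair => //.
  exact: measurableX.
rewrite /lebesgue_cons /pushforward -comp_preimage.
rewrite (_ : _ \o _ = id); last by apply/funext => z /=; rewrite cons_pairK.
by rewrite preimage_id product_measure1E// lte_mul_pinfty// ge0_fin_numE.
Qed.

HB.instance Definition _ := Measure_isSigmaFinite.Build _ _ _ lebesgue_cons
  lebesgue_cons_sigma_finite.

End lebesgue_tuple_step.

Fixpoint lebesgue_tuple (R : realType) (d : nat) :
    {sigma_finite_measure set RR[R]_d -> \bar R} :=
  if d is d0.+1 return {sigma_finite_measure set RR[R]_d -> \bar R}
  then lebesgue_cons (lebesgue_tuple R d0) else \d_([tuple] : RR[R]_0).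

Section surface_measure.
Variables (R : realType) (d : nat).
Implicit Types x : RR[R]_d.

Definition enorm x : R := Num.sqrt (\sum_(i < d) tnth x i ^+ 2).

Definition usphere : set RR[R]_d := [set x | enorm x = 1].

Definition direction x : RR[R]_d := [tuple tnth x i / enorm x | i < d].

(* The set [{r xi | 0 < r <= 1, xi \in A}] for [A `<=` usphere]. *)
Definition solid_cone (A : set RR[R]_d) : set RR[R]_d :=
  [set x | 0 < enorm x <= 1] `&` direction @^-1` A.

(* Polar coordinates: the surface measure of [A] is [d] times the volume of
   the part of the unit ball seen from the origin through [A]. *)
Definition surface_measure (A : set RR[R]_d) : \bar R :=
  (d%:R%:E * lebesgue_tuple R d (solid_cone A))%E.

Lemma measurable_enorm : measurable_fun setT enorm.
Proof.
rewrite /enorm; apply: measurableT_comp.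
  by apply: continuous_measurable_fun; exact: sqrt_continuous.
apply: measurable_sum => i; apply: measurable_funX; exact: measurable_tnth.
Qed.

Lemma measurable_direction : measurable_fun setT direction.
Proof.
apply/measurable_fun_tnthP => i.
rewrite (_ : _ \o _ = fun x => tnth x i * enorm x `^ (-1)); last first.
  by apply/funext => x /=; rewrite tnth_mktuple powR_inv1// sqrtr_ge0.
have mV := measurableT_comp (@measurable_powR R (-1)) measurable_enorm.
exact: (measurable_funM (@measurable_tnth _ (measurableTypeR R) d i) mV).
Qed.

Lemma measurable_solid_cone A : measurable A -> measurable (solid_cone A).
Proof.
move=> mA; apply: measurableI; last first.
  by rewrite -[X in measurable X]setTI; exact: measurable_direction.
rewrite (_ : [set x | _] = enorm @^-1` `]0, 1]%classic); last first.
  by apply/seteqP; split => x /=; rewrite in_itv.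
by rewrite -[X in measurable X]setTI; exact: measurable_enorm.
Qed.

Let surface_measure0 : surface_measure set0 = 0%E.
Proof.
by rewrite /surface_measure /solid_cone preimage_set0 setI0 measure0 mule0.
Qed.

Let surface_measure_ge0 A : (0 <= surface_measure A)%E.
Proof. by rewrite /surface_measure mule_ge0// lee_fin. Qed.

Let surface_measure_sigma_additive : semi_sigma_additive surface_measure.
Proof.
move=> F mF tF mUF; rewrite /surface_measure.
under eq_fun do rewrite -ge0_sume_distrr//.
rewrite /solid_cone preimage_bigcup setI_bigcupr.
apply: cvgeZl => //; apply: measure_semi_sigma_additive.
- by move=> n; exact: measurable_solid_cone.
- apply/trivIsetP => /= i j _ _ ij.
  rewrite setIACA -[_ @^-1` F i `&` _]preimage_setI.
  by move/trivIsetP : tF => /(_ _ _ _ _ ij) ->//; rewrite preimage_set0 setI0.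
- rewrite -setI_bigcupr -preimage_bigcup; exact: measurable_solid_cone.
Qed.

HB.instance Definition _ := isMeasure.Build _ _ _ surface_measure
  surface_measure0 surface_measure_ge0 surface_measure_sigma_additive.

End surface_measure.
Arguments usphere {R d}.
Arguments surface_measure {R d}.

(* Only meaningful for [0 < z]. *)
Definition Gamma (R : realType) (z : R) : R :=
  \int[lebesgue_measure]_(t in `]0, +oo[) (t `^ (z - 1) * expR (- t)).

Definition sphere_area (R : realType) (d : nat) : R :=
  2 * pi `^ (d%:R / 2) / Gamma (d%:R / 2).

Section harmonics.
Variables (R : realType) (d : nat).
Implicit Types f g : mpoly d R.

Definition laplacian f : mpoly d R := \sum_(i < d) mderiv i (mderiv i f).

Definition harmonics (m : nat) : set (mpoly d R) :=
  [set f | f \is ishomog1 m mdeg /\ laplacian f = 0].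

Definition sphere_ip f g : R :=
  (sphere_area R d)^-1 *
  \int[surface_measure]_(xi in usphere) (meval (tnth xi) f * meval (tnth xi) g).

End harmonics.

Section Npoly.
Variable R : realType.

Definition Nrodrigues (n : nat) (p x : R) : R :=
  (- 1) ^+ n * x `^ p * expR x^-1 *
  derive1n n (fun y : R => y `^ (- p + n.*2%:R) * expR (- y^-1)) x.

(* The unique polynomial that agrees with [Nrodrigues n p] on the positive
   half-line; it exists by [NpolyE]. *)
Definition Npoly (n : nat) (p : R) : {poly R} :=
  xget 0 [set P : {poly R} | forall x, 0 < x -> P.[x] = Nrodrigues n p x].

Let derive1n_weight (a : R) (k : nat) : exists Q : {poly R},
  forall x, 0 < x -> derive1n k (fun y : R => y `^ a * expR (- y^-1)) x =
    x `^ (a - k.*2%:R) * expR (- x^-1) * Q.[x].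
Proof.
elim: k => [|k [Q QE]].
  by exists 1 => x x0; rewrite /= subr0 hornerC mulr1.
exists ((a - k.*2%:R)%:P * 'X * Q + Q + 'X^2 * Q^`()) => x x0.
set c := a - k.*2%:R in QE *.
have -> : a - k.+1.*2%:R = c - 2 by rewrite /c doubleS -addn2 natrD opprD addrA.
rewrite derive1nS derive1E.
rewrite (@near_eq_derive _ _ _ _
  (fun y => y `^ c * expR (- y^-1) * Q.[y])); last first.
  by near=> y; apply: QE; near: y; exact: lt_nbhsr.
have d1 : is_derive x 1 (fun y : R => y `^ c) (c * x `^ (c - 1)).
  exact: is_derive1_powR.
have d2 : is_derive x 1 (fun y : R => - y^-1) (x ^- 2).
  rewrite (_ : x ^- 2 = - (- x ^- 2 *: 1)); last first.
    by rewrite scaleNr opprK /GRing.scale/= mulr1.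
  have dV := @is_deriveV R id x 1 1 (lt0r_neq0 x0) (is_derive_id x (1 : R)).
  exact: (is_deriveN dV).
have d3 : is_derive x 1 (fun y : R => expR (- y^-1)) (expR (- x^-1) * x ^- 2).
  exact: (@is_derive1_comp R expR (fun y => - y^-1) x _ _
    (is_derive_expR (- x^-1)) d2).
have d4 : is_derive x 1 (horner Q) Q^`().[x].
  by rewrite derivE derive1E; apply: DeriveDef => //; exact: derivable_horner.
rewrite (@derive_val _ _ _ _ _ _ _ (is_deriveM (is_deriveM d1 d3) d4)).
have xc : x `^ c = x `^ (c - 2) * x ^+ 2.
  by rewrite -powR_mulrn ?ltW// -powRD ?subrK// (lt0r_neq0 x0) implybT.
have xc1 : x `^ (c - 1) = x `^ (c - 2) * x.
  rewrite -{3}(powRr1 (ltW x0)) -powRD ?(lt0r_neq0 x0) ?implybT//.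
  by congr (_ `^ _); ring.
rewrite /GRing.scale /= [X in X * Q^`().[x]](_ : _ = x `^ c * expR (- x^-1))//.
rewrite !hornerE /= xc xc1; field.
exact: lt0r_neq0.
Unshelve. all: by end_near. Qed.

Lemma NpolyE (n : nat) (p x : R) : 0 < x -> (Npoly n p).[x] = Nrodrigues n p x.
Proof.
move=> x_gt0; have [Q QE] := derive1n_weight (- p + n.*2%:R) n.
have PE : [set P : {poly R} | forall x, 0 < x -> P.[x] = Nrodrigues n p x]
    ((- 1) ^+ n *: Q); last exact: (xgetPex 0 (ex_intro _ _ PE)).
move=> {x_gt0}x x0 /=.
rewrite hornerZ /Nrodrigues QE// addrK powRN expRN; field.
by rewrite !lt0r_neq0 ?expR_gt0 ?powR_gt0.
Qed.

End Npoly.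

Section cone.
Variables (R : realType) (d : nat).

(* Polynomials in [(x, t)] have [d.+1] variables, of which [t] is the last. *)
Implicit Types f g q : mpoly d.+1 R.

Definition eval_xt f (x : RR[R]_d) (t : R) : R :=
  meval (tnth [tuple of rcons x t]) f.

Definition cone_poly : mpoly d.+1 R :=
  \sum_(i < d) mpolyX R (mnm1 (widen_ord (leqnSn d) i)) ^+ 2
  - mpolyX R (mnm1 ord_max) ^+ 2.

Definition eq_mod_cone f g : Prop := exists h, f - g = h * cone_poly.

Definition cone_integral (F : RR[R]_d -> R -> R) : R :=
  \int[lebesgue_measure]_(t in `[0, +oo[) (t ^+ d.-1 *
    \int[surface_measure]_(xi in usphere) F [tuple t * tnth xi i | i < d] t).

Definition cone_weight (p t : R) : R := t `^ (- p) * expR (- t^-1).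

Definition cone_ip (p : R) f g : R :=
  (sphere_area R d * Gamma (p - d%:R))^-1 *
  cone_integral (fun x t => eval_xt f x t * eval_xt g x t * cone_weight p t).

(* [mmeasure mdeg f] is the total degree plus one, and 0 if [f = 0]. *)
Definition cone_orth_space (p : R) (n : nat) : set (mpoly d.+1 R) :=
  [set f | (exists2 g, eq_mod_cone f g & (mmeasure mdeg g <= n.+1)%N) /\
           (forall q, (mmeasure mdeg q <= n)%N -> cone_ip p f q = 0)].

Definition Spoly (p : R) (n m : nat) (Y : mpoly d R) : mpoly d.+1 R :=
  (map_poly (@mpolyC d.+1 R)
     (Npoly (n - m) (p - (2 * m)%:R - d%:R + 1))).[mpolyX R (mnm1 ord_max)]
  * mwiden Y.

End cone.

(* [b] is a basis of the subspace [V] modulo the congruence [eqv]. *)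
Definition is_basis_mod (R : realType) (U : lmodType R) (eqv : U -> U -> Prop)
    (V : set U) (I : finType) (b : I -> U) : Prop :=
  [/\ forall i, V (b i),
      forall c : I -> R, eqv (\sum_i c i *: b i) 0 -> forall i, c i = 0 &
      forall f, V f -> exists c : I -> R, eqv f (\sum_i c i *: b i)].

(* Main.v *)
(* On the section of the cone at height [t], i.e. the sphere of radius [t], the
   product of [N(t) Y(x)] and [N'(t) Y'(x)] with [Y], [Y'] homogeneous of
   degrees [m], [m'] integrates to [t ^ (m + m') N(t) N'(t)] times the integral
   of [Y Y'] over the unit sphere. So the inner product splits into a spherical
   and a one-dimensional factor.

   Spherical factor: the integral over the sphere of a homogeneous polynomial
   [f] of degree [k] is [d + k] times its integral over the unit ball [B]. On
   [B] the divergence theorem (applied to [(1 - |x|^2) grad f], so without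
   boundary term) reads [int_B (1 - |x|^2) Lap f = 2 k int_B f]; hence, for [k
   > 0], [f] has integral 0 over the sphere as soon as [Lap f] has. If [f] and
   [g] are harmonic then [Lap (f g) = 2 sum_i (D_i f) (D_i g)], and the
   orthogonality of harmonics of different degrees follows by induction on the
   degree.

   One-dimensional factor: with the weight [w_a(t) = t^a e^(-1/t)] the
   Rodrigues formula is [t^(-q) e^(-1/t) N_n = (-1)^n w_(2n-q)^(n)], and
   integrating by parts [n] times gives the orthogonality and the norm. The
   moments of [w_a] are values of Gamma, so that integration by parts amounts
   to the functional equation of Gamma.

   Completeness: a homogeneous polynomial in [x] is a sum of products [|x|^(2s)
   h] with [h] harmonic, [|x|^2 = t^2] on the cone, and the powers of [t] are
   combinations of the [N_i], which have degree exactly [i]. *)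

Require Import Defs.
From HB Require Import structures.
From mathcomp Require Import all_boot all_order all_algebra.
From mathcomp Require Import -(notations) mpoly.
From mathcomp Require Import all_classical all_reals all_analysis.
From mathcomp Require Import measurable_realfun.
From mathcomp Require Import ring lra zify.

Set Implicit Arguments.
Unset Strict Implicit.
Unset Printing Implicit Defensive.

Import Order.TTheory GRing.Theory Num.Theory.
Import numFieldNormedType.Exports.

Local Open Scope classical_set_scope.
Local Open Scope ring_scope.

Local Notation "''Xv_' i" := (mpolyX _ (mnm1 i)) (at level 8, i at level 2).
Local Notation homog k := (ishomog1 k mdeg).

(** * Harmonic polynomials *)

Section harmonic_algebra.
Variables (R : realType) (d : nat).
Implicit Types (f g : mpoly d R).

Definition sqnorm : mpoly d R := \sum_(i < d) 'Xv_i ^+ 2.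

Lemma mderiv_homog f k (i : 'I_d) : f \is homog k -> mderiv i f \is homog k.-1.
Proof.
move=> /dhomogP fk; apply/dhomogP => m; rewrite mcoeff_msupp mcoeff_deriv.
have [f0|] := eqVneq (mcoeff (mnm_add m (mnm1 i)) f) 0.
  by rewrite f0 mul0rn eqxx.
by rewrite -mcoeff_msupp => /fk /=; rewrite mdegD mdeg1 addn1 => <-.
Qed.

Lemma mderiv_homog0 f (i : 'I_d) : f \is homog 0 -> mderiv i f = 0.
Proof.
move=> /dhomogP f0; apply/mpolyP => m; rewrite mcoeff_deriv mcoeff0.
have [->|] := eqVneq (mcoeff (mnm_add m (mnm1 i)) f) 0; first by rewrite mul0rn.
by rewrite -mcoeff_msupp => /f0 /=; rewrite mdegD mdeg1 addn1.
Qed.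

(** Euler's identity, checked on monomials: differentiating in the [i]-th variable and multiplying
    back by it scales a monomial by its [i]-th exponent, and the exponents add up to [k]. *)
Lemma Euler_homog f k : f \is homog k ->
  \sum_(i < d) 'Xv_i * mderiv i f = k%:R *: f.
Proof.
move=> /dhomogP fk; rewrite [in RHS](mpolyE f) scaler_sumr.
under eq_bigr do rewrite [X in mderiv _ X]mpolyE linear_sum mulr_sumr.
rewrite exchange_big; apply: eq_big_seq => m /fk <- /=.
rewrite mdegE natr_sum scaler_suml; apply: eq_bigr => i _.
(* Subtraction of exponents is truncated, so a zero exponent is treated apart; there the scalar
   coefficient vanishes. *)
rewrite mderivZ mderivX; have [mi0|mi] := posnP (m i).
  by rewrite mi0 !scale0r scaler0 mulr0.
rewrite !scalerA -scalerAr -mpolyXD mulrC; congr (_ *: mpolyX _ _).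
apply/mnmP => j; rewrite mnmDE mnmBE mnm1E.
case: eqVneq => [<-|_] /=; [exact: (subnKC mi)|exact: subn0].
Qed.

Lemma laplacianD f g : laplacian (f + g) = laplacian f + laplacian g.
Proof.
by rewrite /laplacian -big_split; apply: eq_bigr => i _; rewrite !mderivD.
Qed.

Lemma laplacianZ c f : laplacian (c *: f) = c *: laplacian f.
Proof.
by rewrite /laplacian scaler_sumr; apply: eq_bigr => i _; rewrite !mderivZ.
Qed.

Lemma laplacian0 : laplacian (0 : mpoly d R) = 0.
Proof. by rewrite -(scale0r (0 : mpoly d R)) laplacianZ !scale0r. Qed.

Lemma laplacian_homog f k : f \is homog k -> laplacian f \is homog k.-2.
Proof.
by move=> fk; apply: rpred_sum => i _; do 2 apply: mderiv_homog.
Qed.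

(** The truncated degree [k.-2] of [laplacian_homog] does not show that degrees 0 and 1 are
    annihilated. *)
Lemma laplacian_homog_lt2 f k : f \is homog k -> (k < 2)%N -> laplacian f = 0.
Proof.
move=> fk k2; apply: big1 => i _; apply: mderiv_homog0.
by move: (mderiv_homog i fk); case: k k2 fk => [|[]].
Qed.

Lemma laplacianM f g : laplacian (f * g) = laplacian f * g + f * laplacian g
  + 2 *: \sum_(i < d) mderiv i f * mderiv i g.
Proof.
rewrite /laplacian mulr_suml mulr_sumr scaler_sumr -!big_split.
apply: eq_bigr => i _ /=; rewrite !mderivM !mderivD !mderivM scaler_nat; ring.
Qed.

Lemma laplacian_mderiv f i : laplacian (mderiv i f) = mderiv i (laplacian f).
Proof.
rewrite /laplacian linear_sum; apply: eq_bigr => j _.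
by rewrite (mderiv_comm i j f) (mderiv_comm i j (mderiv j f)).
Qed.

Lemma mderiv_sqnorm i : mderiv i sqnorm = 2 *: 'Xv_i.
Proof.
rewrite /sqnorm linear_sum (bigD1 i)//= big1 ?addr0 => [|j ji]; last first.
  rewrite expr2 mderivM mderivX mnm1E (negPf ji) scale0r mulr0 mul0r addr0//.
rewrite expr2 mderivM mderivX mnm1E eqxx scale1r.
rewrite (_ : mnm_sub _ _ = mnm0); last by apply/mnmP => j;
  rewrite mnmBE subnn mnm0E.
by rewrite mpolyX0 mul1r mulr1 scaler_nat mulr2n.
Qed.

Lemma sqnorm_homog : sqnorm \is homog 2.
Proof.
apply: rpred_sum => i _; rewrite (_ : 2%N = (1 * 2)%N)//; apply: dhomogMn.
by rewrite dhomogX /= mdeg1.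
Qed.

(** Product rule: the Laplacian of [sqnorm] is [2 * d], and the mixed term is [4 * k] times [f] by
    Euler's identity. *)
Lemma laplacian_sqnorm_mul f k : f \is homog k ->
  laplacian (sqnorm * f) =
    (2 * d%:R + 4 * k%:R) *: f + sqnorm * laplacian f.
Proof.
move=> fk; rewrite laplacianM.
have -> : laplacian sqnorm = mpolyC d (2 * d%:R : R).
  rewrite /laplacian; under eq_bigr => i _.
    rewrite mderiv_sqnorm mderivZ mderivX mnm1E eqxx scale1r.
    rewrite (_ : mnm_sub _ _ = mnm0); last first.
      by apply/mnmP => j; rewrite mnmBE subnn mnm0E.
    rewrite mpolyX0; over.
  by rewrite sumr_const card_ord -scaler_nat scalerA mulrC alg_mpolyC.
under eq_bigr do rewrite mderiv_sqnorm -scalerAl.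
rewrite -scaler_sumr (Euler_homog fk) !scalerA mul_mpolyC.
by rewrite scalerDl -!natrM; ring.
Qed.

(** The eigenvalue of [f |-> laplacian (sqnorm * f)] at [sqnorm ^+ s * h], for [h] harmonic of
    degree [a]. *)
Definition harmonic_eigen (a s : nat) : R :=
  (2 * s.+1 * (2 * s + 2 * a + d))%:R.

Lemma laplacian_sqnorm_exp h a s : harmonics a h ->
  laplacian (sqnorm ^+ s.+1 * h) = harmonic_eigen a s *: (sqnorm ^+ s * h).
Proof.
move=> [ha lh]; elim: s => [|s IH].
  rewrite expr1 expr0 mul1r (laplacian_sqnorm_mul ha) lh mulr0 addr0.
  by congr (_ *: _); rewrite /harmonic_eigen; ring.
have hs : sqnorm ^+ s.+1 * h \is homog (2 * s.+1 + a)%N.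
  by apply: dhomogM => //; apply: dhomogMn; exact: sqnorm_homog.
rewrite [sqnorm ^+ s.+2]exprS -mulrA (laplacian_sqnorm_mul hs) IH -scalerAr
  mulrA -exprS.
rewrite -scalerDl; congr (_ *: _); rewrite /harmonic_eigen; ring.
Qed.

Lemma iter_laplacian_homog f k s : f \is homog k ->
  iter s (@laplacian R d) f \is homog (k - 2 * s)%N.
Proof.
move=> fk; elim: s => [|s IH]; first by rewrite muln0 subn0.
rewrite iterS mulnS addnC subnDA subn2.
exact: laplacian_homog.
Qed.

Lemma iter_laplacian_eq0 f k s : f \is homog k -> (k < 2 * s)%N ->
  iter s (@laplacian R d) f = 0.
Proof.
elim: s => // s IH fk ks; rewrite iterS; have [ks'|sk] := ltnP k (2 * s).
  by rewrite IH// laplacian0.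
apply: (laplacian_homog_lt2 (iter_laplacian_homog s fk)); lia.
Qed.

Lemma iter_laplacianD s f g : iter s (@laplacian R d) (f + g) =
  iter s (@laplacian R d) f + iter s (@laplacian R d) g.
Proof. by elim: s => // s IH; rewrite !iterS IH laplacianD. Qed.

Lemma iter_laplacianZ s c f : iter s (@laplacian R d) (c *: f) =
  c *: iter s (@laplacian R d) f.
Proof. by elim: s => // s IH; rewrite !iterS IH laplacianZ. Qed.

(** Each Laplacian removes one factor [sqnorm] at the cost of a factor [harmonic_eigen], which is
    nonzero because [d > 0]. Division by [C] isolates the harmonic components in
    [harmonic_decomposition]. *)
Lemma iter_laplacian_sqnorm_exp h a s : (0 < d)%N -> harmonics a h ->
  exists2 C : R, C != 0 &
    iter s (@laplacian R d) (sqnorm ^+ s * h) = C *: h.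
Proof.
move=> d0 hh; elim: s => [|s [C C0 IH]].
  by exists 1; rewrite ?oner_eq0// expr0 mul1r scale1r.
exists (harmonic_eigen a s * C).
  by rewrite mulf_neq0// pnatr_eq0 !muln_eq0 !addn_eq0 [d == _]eqn0Ngt d0 andbF.
by rewrite iterSr (laplacian_sqnorm_exp _ hh) iter_laplacianZ IH scalerA.
Qed.

(* Subtracting a suitable multiple of [sqnorm ^+ s * laplacian^s F] lowers the
   order of nilpotency of the Laplacian on [F]. *)
Lemma harmonic_decomposition (V : set (mpoly d R)) k f : (0 < d)%N ->
  V 0 -> (forall u v, V u -> V v -> V (u + v)) ->
  (forall c u, V u -> V (c *: u)) ->
  (forall s a h, (2 * s + a = k)%N -> harmonics a h -> V (sqnorm ^+ s * h)) ->
  f \is homog k -> V f.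
Proof.
move=> d0 V0 VD VZ VH; suff H s F : F \is homog k ->
    iter s (@laplacian R d) F = 0 -> V F.
  by move=> fk; apply: (H k.+1 f fk); apply: (iter_laplacian_eq0 fk); lia.
elim: s F => [F _ /= ->//|s IH F Fk Fs].
(* For [k < 2 * s] the [s]-th iterate is already zero, and the truncated [k - 2 * s] would not be a
   genuine degree. *)
have [ks|sk] := ltnP k (2 * s).
  by apply: IH => //; exact: iter_laplacian_eq0 ks.
set h := iter s (@laplacian R d) F.
have hh : harmonics (k - 2 * s) h by split => //; exact: iter_laplacian_homog.
have [C C0 hC] := iter_laplacian_sqnorm_exp s d0 hh.
have hk : sqnorm ^+ s * h \is homog k.
  rewrite -(subnKC sk); apply: dhomogM; last by case: hh.
  by apply: dhomogMn; exact: sqnorm_homog.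
rewrite -[F](subrK (C^-1 *: (sqnorm ^+ s * h))); apply: VD; last first.
  by apply/VZ/(VH _ (k - 2 * s)%N) => //; lia.
apply: IH; first by apply: rpredB => //; exact: rpredZ.
rewrite -scaleNr iter_laplacianD iter_laplacianZ hC scalerA mulNr mulVf//.
by rewrite scaleN1r subrr.
Qed.

End harmonic_algebra.

(** * Moments of the one-dimensional weights *)

Section Rintegral_complements.
Context d (T : measurableType d) (R : realType).
Variable mu : {measure set T -> \bar R}.
Variables (D : set T) (mD : measurable D).
Local Notation intble f := (mu.-integrable D (EFin \o f)).

Lemma integrable_scale (f : T -> R) c : intble f -> intble (fun x => c * f x).
Proof.
by move=> /(integrableZl mD c); apply: eq_integrable.
Qed.

Lemma integrable_add (f g : T -> R) :
  intble f -> intble g -> intble (fun x => f x + g x).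
Proof.
move=> fi gi; by have := integrableD mD fi gi; apply: eq_integrable.
Qed.

Lemma integrable_bigsum (I : Type) (r : seq I) (f : I -> T -> R) :
  (forall i, intble (f i)) -> intble (fun x => \sum_(i <- r) f i x).
Proof.
move=> fi; elim: r => [|i r IH].
  by apply: eq_integrable (integrable0 _ _) => // x _; rewrite /= big_nil.
apply: eq_integrable (integrable_add (fi i) IH) => // x _.
by rewrite /= big_cons.
Qed.

Lemma Rintegral_bigsum (I : Type) (r : seq I) (f : I -> T -> R) :
  (forall i, intble (f i)) ->
  \int[mu]_(x in D) (\sum_(i <- r) f i x) =
    \sum_(i <- r) \int[mu]_(x in D) f i x.
Proof.
move=> fi; elim: r => [|i r IH].
  by under eq_Rintegral do rewrite big_nil;
    rewrite big_nil Rintegral_cst// mul0r.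
under eq_Rintegral do rewrite big_cons.
by rewrite RintegralD ?big_cons ?IH//; exact: integrable_bigsum.
Qed.

End Rintegral_complements.

(** * The weight [x^c e^(-1/x)], its derivatives and the Rodrigues formula *)

Section weight.
Variable R : realType.
Implicit Types (a b c x y z : R) (Q : {poly R}).

(** [cone_weight p] is [invexp (- p)]; the exponent is left free because differentiation shifts
    it. *)
Definition invexp c x : R := x `^ c * expR (- x^-1).

(** Factoring out the power [c - 2] turns all terms of the derivative into polynomials, so the shape
    weight times polynomial is stable under differentiation. *)
Lemma is_derive_invexp_poly c Q x : 0 < x ->
  is_derive x 1 (fun y => invexp c y * Q.[y])
    (invexp (c - 2) x * ((c *: 'X + 1) * Q + 'X^2 * Q^`()).[x]).
Proof.
move=> x0; have x_neq0 := lt0r_neq0 x0.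
have d1 : is_derive x 1 (fun y : R => y `^ c) (c * x `^ (c - 1)).
  exact: is_derive1_powR.
have d2 : is_derive x 1 (fun y : R => - y^-1) (x ^- 2).
  have := is_deriveN (@is_deriveV R id x 1 1 x_neq0 (is_derive_id x (1 : R))).
  by rewrite scaleNr opprK /GRing.scale/= mulr1.
have d3 := @is_derive1_comp R expR (fun y => - y^-1) x _ _
  (is_derive_expR (- x^-1)) d2.
have d4 : is_derive x 1 (horner Q) Q^`().[x].
  by rewrite derivE derive1E; apply: DeriveDef => //; exact: derivable_horner.
apply: (is_derive_eq (is_deriveM (is_deriveM d1 d3) d4)).
have xc2 : x `^ c = x `^ (c - 2) * x ^+ 2.
  by rewrite -powR_mulrn ?ltW// -powRD ?subrK// x_neq0 implybT.
have xc1 : x `^ (c - 1) = x `^ (c - 2) * x.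
  rewrite -{3}(powRr1 (ltW x0)) -powRD ?x_neq0 ?implybT//.
  by congr (_ `^ _); ring.
rewrite /GRing.scale /= [X in X * Q^`().[x]](_ : _ = x `^ c * expR (- x^-1))//.
by rewrite /invexp !hornerE xc2 xc1 /=; field.
Qed.

Lemma is_derive_invexp c x : 0 < x ->
  is_derive x 1 (invexp c) (c * invexp (c - 1) x + invexp (c - 2) x).
Proof.
move=> x0; rewrite (_ : invexp c = fun y => invexp c y * 1.[y]); last first.
  by apply/funext => y; rewrite hornerE mulr1.
apply: (is_derive_eq (is_derive_invexp_poly c 1 x0)).
have -> : ((c *: 'X + 1) * 1 + 'X^2 * (1 : {poly R})^`()).[x] = c * x + 1.
  by rewrite -polyC1 derivC !hornerE /=; ring.
rewrite mulrDr mulr1; congr (_ + _).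
rewrite mulrCA /invexp; congr (_ * _).
rewrite mulrAC -{2}(powRr1 (ltW x0)) -powRD ?(lt0r_neq0 x0) ?implybT//.
by congr (_ `^ _ * _); ring.
Qed.

(** The polynomial factor of the [k]-th derivative of [invexp a], by the recursion read off
    [is_derive_invexp_poly]. *)
Fixpoint wpoly a k : {poly R} :=
  if k is k'.+1 then
    let c := a - k'.*2%:R in
    (c *: 'X + 1) * wpoly a k' + 'X^2 * (wpoly a k')^`()
  else 1.

Lemma derive1n_invexp a k x : 0 < x ->
  derive1n k (invexp a) x = invexp (a - k.*2%:R) x * (wpoly a k).[x].
Proof.
elim: k x => [|k IH] x x0; first by rewrite /= subr0 hornerC mulr1.
have -> : a - k.+1.*2%:R = a - k.*2%:R - 2.
  by rewrite doubleS -addn2 natrD opprD addrA.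
rewrite derive1nS derive1E (@near_eq_derive _ _ _ _
  (fun y => invexp (a - k.*2%:R) y * (wpoly a k).[y])).
- exact: (@derive_val _ _ _ _ _ _ _ (is_derive_invexp_poly _ _ x0)).
- by near=> y; apply: IH; near: y; exact: lt_nbhsr.
Unshelve. all: by end_near. Qed.

(** Otherwise the nonzero polynomial [P - Q] would have as many roots as its size, namely the first
    positive integers. *)
Lemma poly_eq_pos (P Q : {poly R}) : (forall x, 0 < x -> P.[x] = Q.[x]) ->
  P = Q.
Proof.
move=> PQ; apply/eqP; rewrite -subr_eq0; apply/negPn/negP => PQ0.
pose s : seq R := [seq n.+1%:R | n <- iota 0 (size (P - Q)%R)].
suff : (size s < size (P - Q)%R)%N by rewrite size_map size_iota ltnn.
apply: max_poly_roots => //.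
  apply/allP => _ /mapP[n _ ->]; rewrite /root hornerD hornerN PQ ?ltr0n//.
  by rewrite subrr.
by rewrite map_inj_uniq ?iota_uniq// => m n /eqP; rewrite eqr_nat => /eqP[].
Qed.

(** After [n] derivatives the exponent [2n - q] has become [- q], so the prefactor of the Rodrigues
    formula cancels the weight exactly. This makes the polynomial chosen by [xget] explicit. *)
Lemma Npoly_wpoly n q :
  Npoly n q = (- 1) ^+ n *: wpoly (n.*2%:R - q) n.
Proof.
apply: poly_eq_pos => x x0; rewrite NpolyE// /Nrodrigues hornerZ.
rewrite (addrC (- q)) [derive1n _ _ _](derive1n_invexp _ _ x0) /invexp.
rewrite addrAC subrr add0r powRN expRN; field.
by rewrite !lt0r_neq0 ?expR_gt0 ?powR_gt0.
Qed.

Lemma size_wpoly a k : (size (wpoly a k) <= k.+1)%N.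
Proof.
elim: k => [|k IH]; first by rewrite size_poly1.
rewrite /=; set c := a - _; apply: (leq_trans (size_polyD _ _)).
rewrite geq_max; apply/andP; split.
  apply: (leq_trans (size_polyMleq _ _)).
  have : (size (c *: 'X + 1)%R <= 2)%N.
    apply: (leq_trans (size_polyD _ _)); rewrite size_poly1 geq_max andbT.
    by apply: (leq_trans (size_scale_leq _ _)); rewrite size_polyX.
  lia.
apply: (leq_trans (size_polyMleq _ _)); rewrite size_polyXn.
have [->|Q0] := eqVneq (wpoly a k) 0; first by rewrite deriv0 size_poly0.
by have := lt_size_deriv Q0; lia.
Qed.

(** From [k] to [k + 1] the leading coefficient is multiplied by [a - 2k], from the term in ['X],
    plus [k], from the derivative; together [a - k]. *)
Lemma coef_wpoly a k : (wpoly a k)`_k = \prod_(i < k) (a - i%:R).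
Proof.
elim: k => [|k IH]; first by rewrite big_ord0 coef1.
rewrite big_ord_recr -IH [LHS]/= coefD mulrDl mul1r coefD -scalerAl coefZ.
rewrite coefXM coefXnM /= (nth_default _ (size_wpoly a k)) addr0.
case: k IH => [|k] IH; first by rewrite /= subr0 addr0 mulrC.
rewrite !subSS subn0 coef_deriv /= -addnn natrD -mulr_natr.
set w := _`_k.+1; ring.
Qed.

End weight.

(** * Gamma as the moments of the weights, and its functional equation *)

Section gamma.
Variable R : realType.
Implicit Types (a b c x y z : R).
Local Notation mu := (@lebesgue_measure R).
Local Notation Rpos := (`]0%R, +oo[%classic : set R).

(** Compact intervals that exhaust the open half-line. Substitution and the fundamental theorem of
    calculus are applied on them before passing to the limit; each is stable under inversion. *)
Let E n : set (measurableTypeR R) := `[n.+1%:R^-1, n.+1%:R]%classic.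

Let mE n : measurable (E n). Proof. exact: measurable_itv. Qed.

Let E_gt0 n x : E n x -> 0 < x.
Proof.
by rewrite /E /= in_itv/= => /andP[+ _]; apply: lt_le_trans; rewrite invr_gt0.
Qed.

Let nondecreasing_E : nondecreasing_seq E.
Proof.
move=> m n mn; apply/subsetPset => x; rewrite /E /= !in_itv/= => /andP[mx xm].
apply/andP; split.
  by apply: le_trans mx; rewrite lef_pV2 ?posrE// ler_nat.
by apply: le_trans xm _; rewrite ler_nat.
Qed.

Let bigcup_E : \bigcup_n E n = `]0, +oo[%classic.
Proof.
apply/seteqP; split => [x [n _ /E_gt0]|x]; rewrite /= in_itv/= andbT// => x0.
exists (maxn (Num.trunc x) (Num.trunc x^-1)) => //; rewrite /E /= in_itv/=.
apply/andP; split; last first.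
  apply/ltW/(lt_le_trans (truncnS_gt x)).
  by rewrite ler_nat ltnS leq_maxl.
rewrite -[leRHS]invrK lef_pV2 ?posrE ?invr_gt0//.
apply/ltW/(lt_le_trans (truncnS_gt _)).
by rewrite ler_nat ltnS leq_maxr.
Qed.

Lemma cvg_integral_pos (f : R -> R) : measurable_fun Rpos f ->
  (forall x, 0 < x -> 0 <= f x) ->
  (\int[mu]_(x in E n) (f x)%:E @[n --> \oo] -->
   \int[mu]_(x in Rpos) (f x)%:E)%E.
Proof.
move=> mf f0; rewrite -bigcup_E;
  apply: ge0_nondecreasing_set_cvg_integral => //.
- move=> i; apply/measurable_EFinP; apply: measurable_funS mf => //.
  by rewrite -bigcup_E; exact: bigcup_sup.
- by move=> i x /E_gt0 x0; rewrite lee_fin f0.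
Qed.

Lemma continuous_invexp c x : 0 < x -> {for x, continuous (invexp c)}.
Proof.
move=> x0; apply/differentiable_continuous; rewrite -derivable1_diffP.
exact: (@ex_derive _ _ _ _ _ _ _ (is_derive_invexp c x0)).
Qed.

Lemma measurable_invexp c : measurable_fun Rpos (@invexp R c).
Proof.
apply: open_continuous_measurable_fun; first exact: interval_open.
by move=> x; rewrite inE/= in_itv/= andbT; exact: continuous_invexp.
Qed.

Lemma invexp_ge0 c x : 0 <= invexp c x.
Proof. by rewrite mulr_ge0 ?powR_ge0 ?expR_ge0. Qed.

(** Substitute [x^-1] for [x] on each [E n] and let [n] tend to infinity. The equality is one of
    extended reals, both of which may be infinite. *)
Lemma integral_invexpE b :
  (\int[mu]_(x in Rpos) (invexp b x)%:E =
   \int[mu]_(x in Rpos) (x `^ (- 1 - b - 1) * expR (- x))%:E)%E.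
Proof.
pose G x := x `^ (- 1 - b - 1) * expR (- x).
have mG : measurable_fun Rpos G.
  apply: (@measurable_funS _ _ _ _ setT) => //; apply: measurable_funM.
    exact: measurable_powR.
  by apply: measurableT_comp => //; exact: measurableT_comp.
have G0 x : 0 < x -> 0 <= G x.
  by move=> _; rewrite mulr_ge0 ?powR_ge0 ?expR_ge0.
have dG x : 0 < x -> derivable G x 1.
  move=> x0; apply: derivableM.
    by apply: derivable_powR; rewrite in_itv/= andbT.
  apply/derivable1_diffP/differentiable_comp => //.
  exact/derivable1_diffP/derivable_expR.
have c1 := cvg_integral_pos (measurable_invexp b) (fun x _ => invexp_ge0 b x).
have c2 := cvg_integral_pos mG G0.
apply: (cvg_unique _ c1); first exact: ereal_hausdorff.
suff <- : (fun n => \int[mu]_(x in E n) (G x)%:E)%E =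
    (fun n => \int[mu]_(x in E n) (invexp b x)%:E)%E by exact: c2.
apply/funext => n.
have n0 : 0 < n.+1%:R^-1 :> R by rewrite invr_gt0.
have dV x : 0 < x -> is_derive x 1 (@GRing.inv R) (- x ^- 2).
  move=> x0; have := @is_deriveV R id x 1 1 (lt0r_neq0 x0) (is_derive_id x (1 :
    R)).
  by rewrite /GRing.scale/= mulr1.
have dVE x : 0 < x -> derive1 (@GRing.inv R) x = - x ^- 2.
  by move=> x0; rewrite derive1E; exact: (@derive_val _ _ _ _ _ _ _ (dV x x0)).
have cV x : 0 < x -> {for x, continuous (fun y : R => - y ^- 2)}.
  move=> x0; apply: cvgN; apply: cvgV; first by rewrite expf_neq0 ?lt0r_neq0.
  exact: exprn_continuous.
have cV' x : 0 < x -> derive1 (@GRing.inv R) y @[y --> x] --> derive1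
  (@GRing.inv R) x.
  move=> x0; rewrite dVE//.
  apply: cvg_trans (cV x x0); apply: near_eq_cvg; near=> y; rewrite dVE//.
  by near: y; exact: lt_nbhsr.
have n1 : (n.+1%:R^-1 : R) <= n.+1%:R.
  by apply: (@le_trans _ _ 1); rewrite ?invf_le1 ?ler1n.
(* Inversion exchanges the endpoints of [E n], so the domain is the same on both sides. *)
have := @integration_by_substitution_decreasing R (@GRing.inv R) G
  n.+1%:R^-1 n.+1%:R n1.
rewrite invrK => ->.
- apply: eq_integral => x; rewrite inE => /E_gt0 x0; congr EFin.
  transitivity (G x^-1 * - derive1 (@GRing.inv R) x) => //.
  rewrite dVE// opprK /invexp /G -powR_inv1 ?ltW// -powRrM mulN1r.
  rewrite mulrAC; congr (_ * _).
  rewrite -powR_invn ?ltW// -powRD ?(lt0r_neq0 x0) ?implybT//.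
  by congr (_ `^ _); ring.
- move=> x y /E_gt0 x0 /E_gt0 y0 xy.
  by rewrite ltf_pV2 ?posrE.
- move=> x; rewrite in_itv/= => /andP[nx _]; apply: cV'.
  exact: lt_trans nx.
- apply/cvg_ex; exists (- (n.+1%:R^-1) ^- 2).
  by rewrite -dVE//; apply: cvg_at_right_filter; exact: cV'.
- apply/cvg_ex; exists (- (n.+1%:R) ^- 2).
  by rewrite -dVE//; apply: cvg_at_left_filter; exact: cV'.
- split.
  + move=> x; rewrite in_itv/= => /andP[nx _].
    exact: (@ex_derive _ _ _ _ _ _ _ (dV x (lt_trans n0 nx))).
  + by apply: cvg_at_right_filter; apply: cvgV => //; rewrite lt0r_neq0.
  + by apply: cvg_at_left_filter; apply: cvgV.
- apply: derivable_within_continuous => x /E_gt0; exact: dG.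
Unshelve. all: by end_near. Qed.

(** The inequality [x / s <= expR (x / s)] raised to the power [s]. *)
Lemma powR_le_expR s x : 0 < s -> 0 <= x -> x `^ s <= s `^ s * expR x.
Proof.
move=> s0 x0; have s_neq0 := lt0r_neq0 s0.
have xs0 : 0 <= x / s by rewrite divr_ge0// ltW.
have -> : expR x = expR (x / s) `^ s by rewrite -expRM divfK.
have -> : x `^ s = s `^ s * (x / s) `^ s.
  by rewrite -powRM// ?(ltW s0)// mulrC divfK.
rewrite ler_wpM2l ?powR_ge0//; apply: ge0_ler_powR;
  rewrite ?nnegrE ?expR_ge0 ?(ltW s0)//.
by apply: le_trans (expR_ge1Dx _); rewrite lerDr.
Qed.

(** A majorant without singularity at 0. It is [powR_le_expR] at [1 + x^-1 = (1 + x) / x] with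
    exponent [- b]; the factor [expR 1] is what remains of [expR (1 + x^-1)] after multiplication by
    [expR (- x^-1)]. *)
Lemma invexp_le b x : b < 0 -> 0 < x ->
  invexp b x <= (- b) `^ (- b) * expR 1 * (1 + x) `^ b.
Proof.
move=> b0 x0; have x1 : 0 < 1 + x by rewrite addr_gt0.
have xV : (1 + x) / x = 1 + x^-1 by field; exact: lt0r_neq0.
rewrite -ler_pdivrMr ?powR_gt0// -powRN.
have -> : invexp b x * (1 + x) `^ (- b) = (1 + x^-1) `^ (- b) * expR (- x^-1).
  rewrite /invexp mulrAC -xV powRM ?invr_ge0 ?ltW// [X in X * expR _]mulrC.
  by rewrite -powR_inv1 ?ltW// -powRrM mulN1r opprK.
have : (1 + x^-1) `^ (- b) <= (- b) `^ (- b) * expR (1 + x^-1).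
  by apply: powR_le_expR; rewrite ?oppr_gt0// addr_ge0// invr_ge0 ltW.
move=> /(ler_wpM2r (expR_ge0 (- x^-1))) /le_trans; apply.
by rewrite -mulrA -expRD addrK.
Qed.

Lemma cvg_powR_lt0 c : c < 0 -> x `^ c @[x --> +oo] --> (0 : R).
Proof.
move=> c0; rewrite (_ : (fun x => _) = (fun x => (x `^ (- c))^-1)); last first.
  by apply/funext => x; rewrite -powRN opprK.
have : \forall x \near +oo, 0 < x `^ (- c).
  by near=> x; apply: powR_gt0; near: x; exact: nbhs_pinfty_gt.
move=> /gtr0_cvgV0[_]; apply.
apply/cvgryPge => A; near=> x.
have Nc0 : 0 < - c by rewrite oppr_gt0.
(* The bound holds once [x] exceeds [B] to the power [(- c)^-1]; replacing [A] by [B] makes this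
   root meaningful. *)
pose B := Num.max A 0.
apply: (@le_trans _ _ B); first by rewrite le_max lexx.
have B0 : 0 <= B by rewrite le_max lexx orbT.
rewrite -[leLHS](powRr1 B0) -(mulVf (lt0r_neq0 Nc0)) powRrM.
apply: ge0_ler_powR; rewrite ?nnegrE ?powR_ge0 ?(ltW Nc0)//.
Unshelve. all: by end_near. Qed.

(** The primitive [F] tends to 0 at infinity because [b + 1 < 0]. *)
Lemma integrable_1DpowR b : b < - 1 ->
  mu.-integrable Rpos (EFin \o (fun x => (1 + x) `^ b)).
Proof.
move=> b1; have b10 : b + 1 < 0 by lra.
pose F x := (b + 1)^-1 * (1 + x) `^ (b + 1).
have dF x : - 1 < x -> is_derive x 1 F ((1 + x) `^ b).
  move=> x1; have x0 : 0 < 1 + x by lra.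
  have d1 : is_derive x 1 (fun y : R => 1 + y) 1.
    by have := is_deriveD (is_derive_cst (1 : R) x (1 :
      R)) (is_derive_id x (1 : R)); rewrite add0r.
  have d2 := is_derive1_comp (is_derive1_powR (b + 1) x0) d1.
  apply: (is_derive_eq (is_deriveZ (b + 1)^-1 d2)).
  by rewrite /GRing.scale/= addrK; field; lra.
have c1 x : - 1 < x -> {for x, continuous (fun y => (1 + y) `^ b)}.
  move=> x1; have x0 : 0 < 1 + x by lra.
  have d1 : is_derive x 1 (fun y : R => 1 + y) 1.
    by have := is_deriveD (is_derive_cst (1 : R) x (1 :
      R)) (is_derive_id x (1 : R)); rewrite add0r.
  have d2 := is_derive1_comp (is_derive1_powR b x0) d1.
  by apply/differentiable_continuous; rewrite -derivable1_diffP.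
have mf : measurable_fun setT (fun x => (1 + x) `^ b).
  apply: (@measurableT_comp _ _ _ _ _ _ (@powR R ^~ b));
    first exact: measurable_powR.
  exact: measurable_funD.
apply/integrableP; split; first by apply/measurable_EFinP;
  exact: measurable_funS mf.
under eq_integral => x _ do rewrite /= ger0_norm ?powR_ge0//.
apply: (@le_lt_trans _ _ (\int[mu]_(x in `[0%R, +oo[) ((1 + x) `^ b)%:E)%E).
  apply: ge0_subset_integral => //.
  - by apply/measurable_EFinP; exact: measurable_funS mf.
  - by move=> x _; rewrite lee_fin powR_ge0.
  - by move=> x; rewrite /= !in_itv/= !andbT => /ltW.
rewrite (@ge0_continuous_FTC2y _ _ F _ 0) ?ltry//.
- by move=> x _; rewrite powR_ge0.
- apply/continuous_within_itvcyP; split.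
    by move=> x; rewrite in_itv/= andbT => x0; apply: c1; lra.
  by apply: cvg_at_right_filter; apply: c1; lra.
- rewrite -(mulr0 (b + 1)^-1); apply: cvgMl_tmp.
  apply: (@cvg_comp _ _ _ (fun x : R => 1 + x) (fun x => x `^ (b + 1)) _ +oo).
    by apply/cvgryPge => A; near=> x; rewrite -lerBlDl; near: x;
      apply: nbhs_pinfty_ge; rewrite num_real.
  exact: cvg_powR_lt0.
- by move=> x x0; apply: (@ex_derive _ _ _ _ _ _ _ (dF x _)); lra.
- apply: cvg_at_right_filter; apply/differentiable_continuous.
  by rewrite -derivable1_diffP; apply: (@ex_derive _ _ _ _ _ _ _ (dF 0 _)); lra.
- move=> x; rewrite in_itv/= andbT => x0; rewrite derive1E.
  by apply: (@derive_val _ _ _ _ _ _ _ (dF x _)); lra.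
Unshelve. all: by end_near. Qed.

Lemma integrable_invexp b : b < - 1 -> mu.-integrable Rpos (EFin \o invexp b).
Proof.
move=> b1; have b0 : b < 0 by lra.
apply: le_integrable (integrableZl _ ((- b) `^ (- b) * expR 1)
  (integrable_1DpowR b1)) => //.
  by apply/measurable_EFinP; exact: measurable_invexp.
move=> x; rewrite /= in_itv/= andbT => x0.
rewrite lee_fin !ger0_norm ?invexp_ge0 ?mulr_ge0 ?powR_ge0 ?expR_ge0//.
exact: invexp_le.
Qed.

(** In case of divergence both sides are the default value 0 of [fine]. *)
Lemma Rintegral_invexp b : \int[mu]_(x in Rpos) invexp b x = Gamma (- 1 - b).
Proof. by rewrite /Rintegral integral_invexpE. Qed.

Lemma cvg_Rintegral_invexp b : b < - 1 ->
  \int[mu]_(x in E n) invexp b x @[n --> \oo] --> Gamma (- 1 - b).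
Proof.
move=> b1; rewrite -Rintegral_invexp; apply: fine_cvg.
rewrite fineK; last exact: (integrable_fin_num _ (integrable_invexp b1)).
apply: cvg_integral_pos (measurable_invexp b) _ => x _; exact: invexp_ge0.
Qed.

(** Integrate the derivative of [invexp (- z)] over [E n]: its two terms tend to [- z * Gamma z] and
    [Gamma (z + 1)], and the boundary terms tend to 0. *)
Lemma Gamma_recurrence z : 0 < z -> Gamma (z + 1) = z * Gamma z.
Proof.
move=> z0; have b1 : - z - 1 < - 1 by lra.
have b2 : - z - 2 < - 1 by lra.
have l1 := cvg_Rintegral_invexp b1; have l2 := cvg_Rintegral_invexp b2.
rewrite (_ : - 1 - _ = z) in l1; last by ring.
rewrite (_ : - 1 - _ = z + 1) in l2; last by ring.
have E_int b n : mu.-integrable (E n) (EFin \o invexp b).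
  apply: continuous_compact_integrable; first exact: segment_compact.
  apply: derivable_within_continuous => x /E_gt0 x0.
  exact: (@ex_derive _ _ _ _ _ _ _ (is_derive_invexp b x0)).
have FTC n : \int[mu]_(x in E n) invexp (- z - 2) x =
    z * (\int[mu]_(x in E n) invexp (- z - 1) x) +
    (invexp (- z) n.+1%:R - invexp (- z) n.+1%:R^-1).
  (* [E 0] is the single point 1, while the fundamental theorem asks for distinct endpoints. *)
  have [->|n_neq0] := eqVneq n 0%N.
    rewrite /E invr1 set_itv1 !Rintegral_set1 mulr0 add0r subrr//.
  have n_lt : n.+1%:R^-1 < n.+1%:R :> R.
    apply: (@lt_le_trans _ _ 1); rewrite ?ler1n// invf_lt1 ?ltr1n//.
    by rewrite ltnS lt0n.
  have n0 : 0 < n.+1%:R^-1 :> R by rewrite invr_gt0.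
  have cF x : 0 < x -> {for x, continuous (invexp (- z))}.
    exact: continuous_invexp.
  have H : \int[mu]_(x in E n) (- z * invexp (- z - 1) x + invexp (- z - 2) x) =
      invexp (- z) n.+1%:R - invexp (- z) n.+1%:R^-1.
    rewrite /Rintegral (@continuous_FTC2 _ _ (invexp (- z)))//.
    - apply: continuous_in_subspaceT => x; rewrite inE => /E_gt0 x0.
      apply: cvgD; last exact: continuous_invexp.
      by apply: cvgMl_tmp; exact: continuous_invexp.
    - split.
      + move=> x; rewrite in_itv/= => /andP[nx _].
        exact: (@ex_derive _ _ _ _ _ _ _ (is_derive_invexp _ (lt_trans n0 nx))).
      + by apply: cvg_at_right_filter; exact: cF.
      + by apply: cvg_at_left_filter; exact: cF.
    - move=> x; rewrite in_itv/= => /andP[nx _]; rewrite derive1E.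
      apply: (@derive_val _ _ _ _ _ _ _ (is_derive_invexp _ _)).
      exact: lt_trans nx.
  rewrite -H RintegralD//; last first.
    exact: (integrableZl (mE n) (- z) (E_int (- z - 1) n)).
  rewrite RintegralZl// addrCA mulNr addrA addNr add0r//.
have l3 : invexp (- z) n.+1%:R - invexp (- z) n.+1%:R^-1 @[n --> \oo] --> (0 :
  R).
  rewrite -[X in _ --> X](subrr 0); apply: cvgB.
    apply: (@squeeze_cvgr _ _ _ _ (fun=> 0) (fun n => n.+1%:R `^ (- z))).
    - near=> k; rewrite invexp_ge0/= ler_piMr ?powR_ge0//.
    - exact: cvg_cst.
    - apply: (@cvg_comp _ _ _ (fun n => n.+1%:R :
      R) (fun x => x `^ (- z)) _ +oo).
        by rewrite (cvg_shiftS (fun n => n%:R : R)); exact: cvgr_idn.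
      by apply: cvg_powR_lt0; rewrite oppr_lt0.
  have z1 : 0 < z + 1 by lra.
  (* At the left endpoint the value is [(n + 1)^z e^(-(n + 1))]. Taking the exponent [z + 1] in
     [powR_le_expR] gains the factor [1 / (n + 1)] that tends to 0. *)
  apply: (@squeeze_cvgr _ _ _ _ (fun=> 0) (fun n => (z + 1) `^ (z + 1) *
    harmonic n)).
  - near=> k; rewrite invexp_ge0/= /invexp invrK expRN ler_pdivlMr//
    -powR_inv1//.
    rewrite -powRrM mulN1r opprK.
    have := @powR_le_expR (z + 1) k.+1%:R z1 (ler0n _ _).
    rewrite powRD ?pnatr_eq0 ?implybT// powRr1//.
    by rewrite mulrAC ler_pdivrMr ?expR_gt0.
  - exact: cvg_cst.
  - rewrite -[X in _ --> X](mulr0 ((z + 1) `^ (z + 1))).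
    by apply: cvgMl_tmp; exact: cvg_harmonic.
Unshelve.
have l4 := cvgD (cvgMl_tmp (a := z) l1) l3; rewrite addr0 in l4.
apply: (norm_cvg_unique l2).
by apply: cvg_trans (l4 _ _); apply: near_eq_cvg; near=> n; rewrite /= FTC.
Unshelve. all: by end_near. Qed.

(** The integral is at least its part over [[1, 2]], where the integrand is bounded below by a
    positive constant. *)
Lemma Gamma_gt0 z : 0 < z -> 0 < Gamma z.
Proof.
move=> z0; have b1 : - 1 - z < - 1 by lra.
have := Rintegral_invexp (- 1 - z); rewrite subKr.
move=> <-; set b := - 1 - z in b1 *.
have c0 : 0 < 2 `^ b * expR (- 1) :> R by rewrite mulr_gt0 ?powR_gt0 ?expR_gt0.
rewrite -lte_fin /Rintegral fineK; last first.
  exact: (integrable_fin_num _ (integrable_invexp b1)).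
have le_c x : 1 <= x <= 2 -> 2 `^ b * expR (- 1) <= invexp b x.
  move=> /andP[x1 x2]; have x0 : 0 < x by exact: lt_le_trans x1.
  rewrite ler_pM ?powR_ge0 ?expR_ge0//; last first.
    by rewrite ler_expR lerN2 invf_le1.
  rewrite -[b]opprK [in leLHS]powRN [leRHS]powRN lef_pV2 ?posrE ?powR_gt0//.
  by apply: ge0_ler_powR; rewrite ?nnegrE ?(ltW x0)//; lra.
apply: (@lt_le_trans _ _ (\int[mu]_(x in `[1%R,
  2%R]) (2 `^ b * expR (- 1))%:E)%E).
  rewrite integral_cst//= lebesgue_measure_itv/= lte_fin ltr1n -EFinD -EFinM
    lte_fin.
  by rewrite mulr_gt0//; lra.
apply: (@le_trans _ _ (\int[mu]_(x in `[1%R, 2%R]) (invexp b x)%:E)%E).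
  apply: ge0_le_integral => //.
  apply/measurable_EFinP; apply: measurable_funS (measurable_invexp b) => //.
  by move=> x; rewrite /= !in_itv/= andbT => /andP[x1 _]; exact: lt_le_trans x1.
apply: ge0_subset_integral => //.
- by apply/measurable_EFinP; exact: measurable_invexp.
- by move=> x _; rewrite lee_fin invexp_ge0.
- by move=> x; rewrite /= !in_itv/= andbT => /andP[x1 _]; exact: lt_le_trans x1.
Qed.

(** * Moments of polynomials, integration by parts and the norms of [Npoly] *)

Implicit Types (P Q : {poly R}).

(* The integral of [P] against [invexp b] on the half-line, which converges for
   [b + size P < 0]; written with Gamma, it makes sense for all [b] and [P]. *)
Definition wmoment b (P : {poly R}) : R :=
  \sum_(i < size P) P`_i * Gamma (- 1 - b - i%:R).

Lemma wmomentE b P k : (size P <= k)%N ->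
  wmoment b P = \sum_(i < k) P`_i * Gamma (- 1 - b - i%:R).
Proof.
move=> Pk; rewrite /wmoment -(subnKC Pk) big_split_ord /=.
rewrite [X in _ = _ + X]big1 ?addr0// => i _.
by rewrite nth_default ?mul0r//= leq_addr.
Qed.

Lemma wmomentD b P Q : wmoment b (P + Q) = wmoment b P + wmoment b Q.
Proof.
pose k := maxn (size P) (size Q).
rewrite (@wmomentE _ P k) ?leq_maxl// (@wmomentE _ Q k) ?leq_maxr//.
rewrite (@wmomentE _ (P + Q) k) ?size_polyD// -big_split; apply: eq_bigr => i _.
by rewrite coefD mulrDl.
Qed.

Lemma wmomentZ b c P : wmoment b (c *: P) = c * wmoment b P.
Proof.
rewrite (@wmomentE _ (c *: P) (size P)) ?size_scale_leq// mulr_sumr.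
by apply: eq_bigr => i _; rewrite coefZ mulrA.
Qed.

Lemma wmoment0 b : wmoment b 0 = 0.
Proof. by rewrite -(scale0r 0) wmomentZ mul0r. Qed.

Lemma wmoment_sum b (I : Type) (r : seq I) (S : pred I) (F : I -> {poly R}) :
  wmoment b (\sum_(i <- r | S i) F i) = \sum_(i <- r | S i) wmoment b (F i).
Proof. by apply: big_morph; [exact: wmomentD | exact: wmoment0]. Qed.

Lemma wmomentXn b k : wmoment b 'X^k = Gamma (- 1 - b - k%:R).
Proof.
rewrite /wmoment size_polyXn (bigD1 ord_max)//= big1 ?addr0 => [|i ik].
  by rewrite coefXn eqxx mul1r.
by rewrite coefXn (_ : nat_of_ord i == k = false) ?mul0r//; exact: negbTE.
Qed.

Lemma wmomentXnM b k P : wmoment b ('X^k * P) = wmoment (b + k%:R) P.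
Proof.
rewrite -[P in LHS]coefK poly_def mulr_sumr wmoment_sum; apply: eq_bigr => i _.
rewrite -scalerAr -exprD wmomentZ wmomentXn; congr (_ * Gamma _).
by rewrite natrD; ring.
Qed.

Lemma Rintegral_invexp_poly b P (k : nat) : (size P <= k)%N -> b + k%:R < 0 ->
  \int[mu]_(x in Rpos) (P.[x] * invexp b x) = wmoment b P.
Proof.
move=> Pk bk.
(* Since [i + 1 <= k], the condition on [b + k] gives the integrability at infinity of each term. *)
have bi (i : 'I_(size P)) : b + i%:R < - 1.
  have : i.+1%:R <= k%:R :> R by rewrite ler_nat; exact: leq_trans Pk.
  by rewrite -natr1; lra.
have PE x : 0 < x -> P.[x] * invexp b x =
    \sum_(i < size P) P`_i * invexp (b + i%:R) x.
  move=> x0; rewrite horner_coef mulr_suml; apply: eq_bigr => i _.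
  rewrite -mulrA; congr (_ * _); rewrite /invexp mulrA; congr (_ * _).
  by rewrite -powR_mulrn ?ltW// -powRD ?(lt0r_neq0 x0) ?implybT// addrC.
rewrite (@eq_Rintegral _ _ _ mu Rpos
  (fun x => \sum_(i < size P) P`_i * invexp (b + i%:R) x)); last first.
  by move=> x; rewrite inE/= in_itv/= andbT => x0; exact: PE.
have intF (i : 'I_(size P)) :
  mu.-integrable Rpos (EFin \o (fun x => P`_i * invexp (b + i%:R) x)).
  exact/integrable_scale/integrable_invexp/bi.
rewrite Rintegral_bigsum//; apply: eq_bigr => i _.
rewrite RintegralZl; [|exact: measurable_itv|exact/integrable_invexp/bi].
by rewrite Rintegral_invexp opprD addrA.
Qed.

(* The polynomial under [wmoment] is, up to the weight, the derivative of
   [t `^ c * expR (- t^-1) * P.[t]]. *)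
Lemma wmoment_parts c P (k : nat) : (size P <= k.+1)%N -> c + k%:R < 0 ->
  wmoment (c - 2) ((c *: 'X + 1) * P + 'X^2 * P^`()) = 0.
Proof.
move=> Pk ck; rewrite -[P]coefK poly_def linear_sum !mulr_sumr -big_split.
rewrite wmoment_sum big1// => i _; have ik : (i <= k)%N by have := ltn_ord i;
  lia.
rewrite /= derivZ derivXn -!scalerAr -scalerDr wmomentZ.
rewrite mulrDl mul1r -scalerAl -exprS. rewrite mulrnAr.
have -> : ('X^2 * 'X^(i.-1)) *+ i = i%:R *: 'X^(i.+1) :> {poly R}.
  by rewrite scaler_nat; case: (nat_of_ord i) => // j; rewrite -exprD.
(* For the monomial of degree [i] the claim is [(c + i) * Gamma z + Gamma (z + 1) = 0] with
   [z = - c - i]. *)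
rewrite addrAC -scalerDl wmomentD wmomentZ !wmomentXn.
have z0 : 0 < - c - i%:R.
  by have : i%:R <= k%:R :> R by [rewrite ler_nat]; lra.
rewrite (_ : _ - i%:R = - c - i%:R + 1); last by ring.
rewrite (_ : _ - i.+1%:R = - c - i%:R); last by rewrite -natr1; ring.
by rewrite Gamma_recurrence//; ring.
Qed.

(** Integration by parts [k] times, each moving one derivative from the weight to [P]. The
    hypothesis keeps all the arguments of Gamma positive where the functional equation is used. *)
Lemma wmoment_wpoly a k P : a + (size P)%:R < k%:R ->
  wmoment (a - k.*2%:R) (wpoly a k * P) = (- 1) ^+ k * wmoment a P^`(k).
Proof.
elim: k P => [|k IH] P aP; first by rewrite subr0 expr0 !mul1r.
have [->|P0] := eqVneq P 0;
  first by rewrite derivn_poly0 ?size_poly0// mulr0 !wmoment0 mulr0.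
have aP' : a + (size P^`())%:R < k%:R.
  have : (size P^`()).+1%:R <=
    (size P)%:R :> R by rewrite ler_nat lt_size_deriv.
  by rewrite -natr1; move: aP; rewrite -natr1; lra.
have -> : a - k.+1.*2%:R = a - k.*2%:R - 2 by rewrite doubleS -addn2 natrD;
  ring.
rewrite derivSn exprS mulN1r mulNr -IH//; apply/eqP; rewrite -subr_eq0 opprK;
  apply/eqP.
set c := a - _; set Q := wpoly a k.
have -> : wmoment c (Q * P^`()) = wmoment (c - 2) ('X^2 * (Q * P^`())).
  by rewrite wmomentXnM subrK.
rewrite -wmomentD /= -/c -/Q.
(* By the Leibniz rule the two terms form the integrand of [wmoment_parts] for the product
   [Q * P]. *)
rewrite (_ : _ * P + _ = (c *: 'X + 1) * (Q * P) + 'X^2 * (Q * P)^`());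
  last first.
  by rewrite derivM -!mul_polyC; ring.
apply: (@wmoment_parts _ _ (k + (size P).-1)).
  apply: (leq_trans (size_polyMleq _ _)).
  by move: (size_wpoly a k) P0; rewrite -/Q -size_poly_gt0; lia.
rewrite natrD /c -addnn natrD; move: aP; rewrite -natr1.
have : (size P)%:R = (size P).-1%:R + 1 :> R.
  by rewrite natr1 prednK// size_poly_gt0.
lra.
Qed.

Lemma size_Npoly n (q : R) : (size (Npoly n q) <= n.+1)%N.
Proof.
rewrite Npoly_wpoly; apply: (leq_trans (size_scale_leq _ _)); exact: size_wpoly.
Qed.

Lemma coef_Npoly n (q : R) : (Npoly n q)`_n =
  \prod_(i < n) (q - n.*2%:R + i%:R).
Proof.
rewrite Npoly_wpoly coefZ coef_wpoly -[n in (- 1) ^+ n]card_ord.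
by rewrite -prodrN; apply: eq_bigr => i _; ring.
Qed.

Lemma coef_Npoly_gt0 n (q : R) : n.*2%:R < q -> 0 < (Npoly n q)`_n.
Proof.
move=> nq; rewrite coef_Npoly; apply: prodr_gt0 => i _.
by rewrite ltr_wpDr// subr_gt0.
Qed.

(** After [n] integrations by parts only the constant [n]-th derivative of [P] is left, and the sign
    cancels that of the Rodrigues formula. Orthogonality is the case of a zero coefficient of degree
    [n], the norm that of [P = Npoly n q]. *)
Lemma wmoment_Npoly n q P : n.*2%:R + 1 < q -> (size P <= n.+1)%N ->
  wmoment (- q) (Npoly n q * P) = n`!%:R * P`_n * Gamma (q - n.*2%:R - 1).
Proof.
move=> nq Pn.
have Pn' : (size P)%:R <= n%:R + 1 :> R by rewrite natr1 ler_nat.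
have aP : n.*2%:R - q + (size P)%:R < n%:R by lra.
rewrite Npoly_wpoly -scalerAl wmomentZ {1}(_ : - q = n.*2%:R - q - n.*2%:R);
  last by ring.
rewrite wmoment_wpoly// mulrA -exprD addnn -signr_odd odd_double mul1r.
have -> : P^`(n) = (n`!%:R * P`_n)%:P.
  apply/polyP => i; rewrite coef_derivn coefC; case: i => [|i].
    by rewrite addn0 ffactnn mulr_natl.
  by rewrite nth_default ?mul0rn// (leq_trans Pn)// addnS ltnS leq_addr.
rewrite -[_%:P]mulr1 mul_polyC wmomentZ -(expr0 'X) wmomentXn subr0.
by congr (_ * Gamma _); ring.
Qed.

Lemma GammaDn z n : 0 < z -> Gamma (z + n%:R) =
  \prod_(i < n) (z + i%:R) * Gamma z.
Proof.
move=> z0; elim: n => [|n IH]; first by rewrite addr0 big_ord0 mul1r.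
have zn : 0 < z + n%:R by rewrite ltr_wpDr.
by rewrite -natr1 addrA (Gamma_recurrence zn) IH big_ord_recr/=; ring.
Qed.

(** The leading coefficient of [Npoly n q] supplies all the factors between [Gamma (q - 2n - 1)] and
    [Gamma (q - n)] except the first, [q - 2n - 1], which becomes the denominator. *)
Lemma wmoment_Npoly_sqr n q : n.*2%:R + 1 < q ->
  wmoment (- q) (Npoly n q * Npoly n q) =
    n`!%:R * Gamma (q - n%:R) / (q - n.*2%:R - 1).
Proof.
move=> nq; have z0 : 0 < q - n.*2%:R - 1 by lra.
rewrite wmoment_Npoly ?size_Npoly// coef_Npoly.
have -> : q - n%:R = q - n.*2%:R - 1 + n.+1%:R by rewrite -natr1 -addnn natrD;
  ring.
rewrite GammaDn// big_ord_recl addr0.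
have -> : \prod_(i < n) (q - n.*2%:R - 1 + (lift ord0 i)%:R) =
    \prod_(i < n) (q - n.*2%:R + i%:R).
  by apply: eq_bigr => i _; rewrite lift0 -natr1; ring.
by field; exact: lt0r_neq0.
Qed.

Lemma wmoment_Npoly_neq k k' q : k.*2%:R + 1 < q -> k'.*2%:R + 1 < q ->
  k != k' -> wmoment (- q) (Npoly k q * Npoly k' q) = 0.
Proof.
move=> kq kq'; wlog kk : k k' kq kq' / (k' < k)%N => [H|_].
  by rewrite neq_ltn => /orP[kk|kk]; [rewrite mulrC|]; rewrite H// gtn_eqF.
have Nk := leq_trans (size_Npoly k' q) kk.
by rewrite wmoment_Npoly// ?(leq_trans Nk)// nth_default// mulr0 mul0r.
Qed.

End gamma.

(** * Integration over balls and spheres *)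

Section lebesgue_scaling.
Variable R : realType.
Local Notation leb := (@lebesgue_measure R).

(** The right-hand side is a measure in [A] that agrees with Lebesgue measure on half-open
    intervals; uniqueness concludes. *)
Lemma lebesgue_measure_scale (r : R) (A : set (measurableTypeR R)) : 0 < r ->
  measurable A -> (leb A = r%:E * leb ((fun x => r * x)%R @^-1` A))%E.
Proof.
move=> r0 mA; pose k := NngNum (ltW r0).
have mr : measurable_fun setT (fun x : measurableTypeR R => r * x :
  measurableTypeR R).
  exact: measurable_funM.
pose pm : {measure set (measurableTypeR R) -> \bar R} :=
  measure_function_pushforward__canonical__measure_function_Measure leb mr.
rewrite (@lebesgue_measure_unique R (mscale k pm))//.
move=> _ [[a b]] _ <-.
rewrite -[RHS]/(r%:E * leb ((fun x : R => r * x)%R @^-1` `]a, b]))%E.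
rewrite (_ : _ @^-1` _ = `](a / r), (b / r)]%classic); last first.
  by apply/seteqP; split => x /=;
    rewrite !in_itv/= ltr_pdivrMr// ler_pdivlMr// mulrC.
rewrite !lebesgue_measure_itv/= !lte_fin ltr_pM2r ?invr_gt0//.
case: ifPn => _; last by rewrite mule0.
by rewrite -!EFinB -EFinM; congr EFin; field; exact: lt0r_neq0.
Qed.

Lemma ge0_integral_scale (r : R) (f : measurableTypeR R -> \bar R) : 0 < r ->
  measurable_fun setT f -> (forall x, 0 <= f x)%E ->
  (\int[leb]_x f x = r%:E * \int[leb]_x f (r * x)%R)%E.
Proof.
move=> r0 mf f0; pose k := NngNum (ltW r0).
have mr : measurable_fun setT (fun x : measurableTypeR R => r * x :
  measurableTypeR R).
  exact: measurable_funM.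
pose pm : {measure set (measurableTypeR R) -> \bar R} :=
  measure_function_pushforward__canonical__measure_function_Measure leb mr.
transitivity (\int[mscale k pm]_x f x)%E.
  by apply: eq_measure_integral => A mA _; exact: lebesgue_measure_scale.
by rewrite ge0_integral_mscale// ge0_integral_pushforward.
Qed.

End lebesgue_scaling.

Section lebesgue_tuple_theory.
Variable R : realType.
Local Notation leb := (@lebesgue_measure R).
Local Notation mu d := (lebesgue_tuple R d).

Definition tscale d (r : R) (x : RR[R]_d) : RR[R]_d :=
  [tuple r * tnth x i | i < d].

Lemma measurable_tscale d r : measurable_fun setT (@tscale d r).
Proof.
apply/measurable_fun_tnthP => i.
rewrite (_ : _ \o _ = fun x => r * tnth x i); last first.
  by apply/funext => x /=; rewrite tnth_mktuple.
apply: measurable_funM => //; exact: measurable_tnth.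
Qed.

Lemma ge0_integral_cons d (f : RR[R]_d.+1 -> \bar R) :
  measurable_fun setT f -> (forall x, 0 <= f x)%E ->
  (\int[mu d.+1]_x f x = \int[leb]_s \int[mu d]_x f (cons_pair (s, x)))%E.
Proof.
move=> mf f0.
have mc := @measurable_cons_pair R d.
have mfc : measurable_fun setT (f \o @cons_pair R d) by exact: measurableT_comp
  mf mc.
have fc0 z : (0 <= (f \o @cons_pair R d) z)%E by exact: f0.
have <- := fubini_tonelli1 (m1 := leb) (m2 := mu d) _ mfc fc0.
by rewrite -(@ge0_integral_pushforward _ _ _ _ _ _ mc _ setT).
Qed.

(** Tonelli and induction on [d]: each coordinate contributes one factor [r]. *)
Lemma ge0_integral_tscale d r (f : RR[R]_d -> \bar R) : 0 < r ->
  measurable_fun setT f -> (forall x, 0 <= f x)%E ->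
  (\int[mu d]_x f x = (r ^+ d)%:E * \int[mu d]_x f (tscale r x))%E.
Proof.
move=> r0; elim: d f => [|d IH] f mf f0.
  rewrite expr0 mul1e; apply: eq_integral => x _; congr f.
  by apply: eq_from_tnth => -[].
have mc := @measurable_cons_pair R d.
have mfc : measurable_fun setT (f \o @cons_pair R d) by exact: measurableT_comp
  mf mc.
have fc0 z : (0 <= (f \o @cons_pair R d) z)%E by exact: f0.
have mF := measurable_fun_fubini_tonelli_F (m2 := mu d) _ mfc fc0.
have mt : measurable_fun setT (@tscale d r).
  exact: measurable_tscale.
have mft : measurable_fun setT (f \o @tscale d.+1 r).
  by apply: measurableT_comp mf _; exact: measurable_tscale.
have mG := measurable_fun_fubini_tonelli_F (m2 := mu d) _
  (measurableT_comp mft mc)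
   (fun z => f0 (tscale r (cons_pair z))).
rewrite !ge0_integral_cons// (ge0_integral_scale r0 mF); last first.
  by move=> s; apply: integral_ge0 => x _; exact: f0.
rewrite exprS EFinM -muleA; congr (_ * _)%E.
rewrite -ge0_integralZl//.
- apply: eq_integral => s _;
  rewrite /fubini_F (IH (fun x => f (cons_pair (r * s, x)))) //.
  + congr (_ * _)%E; apply: eq_integral => x _; congr f.
    by apply: eq_from_tnth => i; rewrite tnth_mktuple /cons_pair;
      case: (unliftP ord0 i) => [j|] ->; rewrite ?tnthS ?tnth0 ?tnth_mktuple.
  + apply: measurableT_comp mf _; apply: measurableT_comp mc _;
    exact: measurable_fun_pair.
- by move=> s _; apply: integral_ge0 => x _; exact: f0.
- by rewrite lee_fin exprn_ge0// ltW.
Qed.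

Section integrable_cons.
Variables (d : nat) (f : RR[R]_d.+1 -> \bar R).
Hypothesis (fi : (mu d.+1).-integrable setT f).

Let mc := @measurable_cons_pair R d.

Let fci : (leb \x mu d)%E.-integrable setT (f \o @cons_pair R d).
Proof.
have [mf foo] := integrableP _ _ _ fi; apply/integrableP; split.
  exact: measurableT_comp mf mc.
apply: le_lt_trans foo; rewrite le_eqVlt; apply/orP; left; apply/eqP/esym.
apply: (ge0_integral_pushforward mc) => //.
exact: measurableT_comp mf.
Qed.

Let integral_prod : (\int[mu d.+1]_x f x =
  \int[leb \x mu d]_z f (cons_pair z))%E.
Proof.
have [mf foo] := integrableP _ _ _ fi.
exact: (integral_pushforward mc mf).
Qed.

Lemma integral_cons :
  (\int[mu d.+1]_x f x = \int[leb]_s \int[mu d]_x f (cons_pair (s, x)))%E.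
Proof. by rewrite integral_prod -integral12_prod_meas1. Qed.

Lemma integral_cons_swap :
  (\int[mu d.+1]_x f x = \int[mu d]_x \int[leb]_s f (cons_pair (s, x)))%E.
Proof. by rewrite integral_prod -integral21_prod_meas1. Qed.

End integrable_cons.

(** Cubes are products, so their measure is immediate. They bound the measure of balls, and
    [tcube 0] serves as the origin. *)
Definition tcube d (r : R) : set RR[R]_d := [set x | forall i,
  `|tnth x i| <= r].

Lemma tcube_cons d r :
  @cons_pair R d @^-1` (tcube r) = `[- r, r]%classic `*` tcube r.
Proof.
apply/seteqP; split => [[s x]|[s x]] /=.
  move=> H; split => [|i]; last by have := H (lift ord0 i); rewrite tnthS.
  by have := H ord0; rewrite tnth0 in_itv/= ler_norml.
rewrite in_itv/= -ler_norml => -[sr H] i.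
by case: (unliftP ord0 i) => [j|] ->; rewrite ?tnthS ?tnth0.
Qed.

Lemma measurable_tcube d r : measurable (@tcube d r).
Proof.
rewrite (_ : tcube r = \bigcap_(i in [set: 'I_d])
    ((fun x : RR[R]_d => tnth x i) @^-1` `[- r, r]%classic)); last first.
  apply/seteqP; split => x /=.
    by move=> H i _ /=; rewrite in_itv/= -ler_norml.
  by move=> H i; have := H i I; rewrite /= in_itv/= -ler_norml.
apply: fin_bigcap_measurable => // i _.
rewrite -[X in measurable X]setTI; exact: measurable_tnth.
Qed.

Lemma tcube_lty d r : (mu d (tcube r) < +oo)%E.
Proof.
elim: d => [|d IH]; first by rewrite /= diracE ltry.
rewrite [mu _ _](_ : _ = (leb \x mu d)%E (@cons_pair R d @^-1` (tcube r)))//.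
rewrite tcube_cons product_measure1E//; last exact: measurable_tcube.
apply: lte_mul_pinfty => //.
rewrite ge0_fin_numE// [X in (X < _)%E](_ : _ = leb `[- r, r]%classic)//.
by rewrite lebesgue_measure_itv/=; case: ifP => // _; rewrite -EFinB ltry.
Qed.

Lemma tcube0 d : (mu d.+1 (tcube 0) = 0)%E.
Proof.
rewrite [LHS](_ : _ = (leb \x mu d)%E (@cons_pair R d @^-1` (tcube 0)))//.
rewrite tcube_cons product_measure1E//; last exact: measurable_tcube.
rewrite oppr0 set_itv1 [X in (X * _)%E](_ : _ = leb [set 0])//.
by rewrite lebesgue_measure_set1 mul0e.
Qed.

(** The parameter is the squared radius, possibly negative, so that the section of a ball at first
    coordinate [s] is the ball of parameter [c - s ^+ 2]. *)
Definition tball d (c : R) : set RR[R]_d := [set x | \sum_i tnth x i ^+ 2 <= c].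

Lemma measurable_tball d c : measurable (@tball d c).
Proof.
rewrite (_ : tball c = (fun x : RR[R]_d => \sum_i tnth x i ^+ 2) @^-1` `]-oo,
  c]%classic); last first.
  by apply/seteqP; split => x; rewrite /= in_itv.
rewrite -[X in measurable X]setTI.
have H : measurable_fun setT (fun x : RR[R]_d => \sum_i tnth x i ^+ 2).
  apply: measurable_sum => i; apply: measurable_funX; exact: measurable_tnth.
exact: H.
Qed.

Lemma tball_cube d c : @tball d c `<=` tcube (1 + c).
Proof.
move=> x xc i.
have xi : tnth x i ^+ 2 <= c.
  apply: le_trans xc; rewrite (bigD1 i)//= lerDl.
  by apply: sumr_ge0 => j _; exact: sqr_ge0.
have x0 : 0 <= `|tnth x i| by [].
have : `|tnth x i| ^+ 2 <= c by rewrite real_normK// num_real.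
by move: x0; set t := `|_|; nra.
Qed.

Lemma tball_lty d c : (mu d (tball c) < +oo)%E.
Proof.
apply: le_lt_trans (tcube_lty d (1 + c)); apply: le_measure.
- by rewrite inE; exact: measurable_tball.
- by rewrite inE; exact: measurable_tcube.
- exact: tball_cube.
Qed.

Lemma integrable_tball d c (f : RR[R]_d -> R) C : measurable_fun setT f ->
  (forall x, tball c x -> `|f x| <= C) ->
    (mu d).-integrable (tball c) (EFin \o f).
Proof.
move=> mf fC; apply: measurable_bounded_integrable.
- exact: measurable_tball.
- exact: tball_lty.
- exact: measurable_funS mf.
- exists C; split; first exact: num_real.
  by move=> y Cy x /fC /le_trans; apply; exact: ltW.
Qed.

End lebesgue_tuple_theory.

(** * The divergence theorem on balls for functions vanishing on the boundary *)

Section divergence.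
Variable R : realType.
Local Notation leb := (@lebesgue_measure R).
Local Notation mu d := (lebesgue_tuple R d).

Definition tupd d (i : 'I_d) (x : RR[R]_d) (s : R) : RR[R]_d :=
  [tuple if j == i then s else tnth x j | j < d].

Lemma tnth_cons0 d s (x : RR[R]_d) : tnth (cons_pair (s, x)) ord0 = s.
Proof. by rewrite /cons_pair tnth0. Qed.

Lemma tnth_consS d s (x : RR[R]_d) j : tnth (cons_pair (s,
  x)) (lift ord0 j) = tnth x j.
Proof. by rewrite /cons_pair tnthS. Qed.

Lemma tball_cons d c s (x : RR[R]_d) :
  tball c (cons_pair (s, x)) <-> tball (c - s ^+ 2) x.
Proof.
rewrite -[tball c _]/(is_true (_ <= _)) -[tball _ x]/(is_true (_ <= _)).
rewrite big_ord_recl tnth_cons0 lerBrDl.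
by under eq_bigr do rewrite tnth_consS.
Qed.

Lemma patch_tball_cons d c s (f : RR[R]_d.+1 -> R) (x : RR[R]_d) :
  ((EFin \o f) \_ (tball c)) (cons_pair (s, x)) =
  ((EFin \o (fun y => f (cons_pair (s, y)))) \_ (tball (c - s ^+ 2))) x.
Proof.
rewrite /patch; case: ifPn => [/set_mem/tball_cons H|H].
  by rewrite mem_set.
by rewrite memNset// => /tball_cons/mem_set; exact/negP.
Qed.

Lemma integral_deriv_poly (P : {poly R}) (r : R) : 0 <= r -> P.[r] = 0 ->
  P.[- r] = 0 ->
  (\int[leb]_(s in `[(- r)%R, r]) (P^`().[s])%:E = 0)%E.
Proof.
move=> r0 Pr PNr; have [->|r_neq0] := eqVneq r 0.
  by rewrite oppr0 set_itv1 integral_set1.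
have r_gt0 : 0 < r by rewrite lt_neqAle eq_sym r_neq0.
have rr : - r < r by lra.
rewrite (@continuous_FTC2 _ _ (horner P))//.
- by rewrite Pr PNr subee.
- by apply: continuous_subspaceT => s; exact: continuous_horner.
- split; first by move=> s _; exact: derivable_horner.
  + by apply: cvg_at_right_filter; exact: continuous_horner.
  + by apply: cvg_at_left_filter; exact: continuous_horner.
- by move=> s _; rewrite derivE.
Qed.

(* Fubini: integrate [v] along the lines of direction [i] first. *)
Lemma integral_partial_eq0 d (i : 'I_d) (u v : RR[R]_d -> R) (c C : R) :
  measurable_fun setT v -> (forall x, tball c x -> `|v x| <= C) ->
  (forall x, exists P : {poly R}, forall s,
     u (tupd i x s) = P.[s] /\ v (tupd i x s) = P^`().[s]) ->
  (forall x : RR[R]_d, \sum_j tnth x j ^+ 2 = c -> u x = 0) ->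
  (\int[mu d]_(x in tball c) (v x)%:E = 0)%E.
Proof.
elim: d => [|d IH] in i u v c *; first by case: i.
move=> mv vC uvP u0.
have fi : (mu d.+1).-integrable setT ((EFin \o v) \_ (tball c)).
  apply/(integrable_mkcond _ (measurable_tball c)).
  exact: integrable_tball vC.
rewrite integral_mkcond; case: (unliftP ord0 i) uvP => [j|] -> uvP.
  (* The direction is not the first one: freeze the first coordinate and use induction on the
     section of the ball. *)
  rewrite integral_cons//; apply: integral0_eq => s _.
  under eq_integral do rewrite patch_tball_cons.
  rewrite -integral_mkcond.
  apply: (IH j (fun x => u (cons_pair (s, x)))).
  - apply: measurableT_comp mv _.
    apply: measurableT_comp (@measurable_cons_pair R d) _.
    exact: measurable_fun_pair.
  - by move=> x /tball_cons; exact: vC.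
  - move=> x; have [P PE] := uvP (cons_pair (s, x)); exists P => t.
    have <- : tupd (lift ord0 j) (cons_pair (s, x)) t = cons_pair (s,
      tupd j x t).
      apply: eq_from_tnth => k; rewrite tnth_mktuple.
      case: (unliftP ord0 k) => [l|] ->;
        rewrite ?tnth_cons0// !tnth_consS tnth_mktuple.
      by rewrite (inj_eq lift_inj).
    exact: PE.
  - move=> x xc; apply: u0; rewrite big_ord_recl tnth_cons0.
    by under eq_bigr do rewrite tnth_consS; rewrite xc addrC subrK.
rewrite integral_cons_swap//; apply: integral0_eq => x _.
(* The line through [x] in the first direction meets the ball where [s ^+ 2 <= e]: nowhere if
   [e < 0], and otherwise in a segment whose endpoints lie on the sphere, where [u] vanishes. *)
pose e := c - \sum_j tnth x j ^+ 2.
have tbE s : tball c (cons_pair (s, x)) <-> s ^+ 2 <= e.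
  apply: (iff_trans (tball_cons _ _ _)).
  by rewrite -[tball _ x]/(is_true (_ <= _)) /e lerBrDl addrC -lerBrDl.
have [e0|e0] := ltP e 0.
  apply: integral0_eq => s _; rewrite patchE memNset// => /tbE.
  by rewrite leNgt (lt_le_trans e0)// sqr_ge0.
have [P PE] := uvP (cons_pair (0, x)).
have tE s : tupd ord0 (cons_pair (0, x)) s = cons_pair (s, x).
  apply: eq_from_tnth => k; rewrite tnth_mktuple.
  by case: (unliftP ord0 k) => [l|] ->; rewrite ?tnth_cons0// !tnth_consS.
pose r : R := Num.sqrt e; pose D : set (measurableTypeR R) := `[- r, r]%classic.
transitivity (\int[leb]_s ((EFin \o horner P^`()) \_ D) s)%E.
  apply: eq_integral => s _; rewrite !patchE.
  have -> : (cons_pair (s, x) \in tball c) = (s \in D).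
    apply/idP/idP => /set_mem.
      move/tbE => se; apply/mem_set; rewrite /D /= in_itv/= -ler_norml.
      by rewrite -sqrtr_sqr ler_wsqrtr.
    rewrite /D /= in_itv/= -ler_norml => sr; apply/mem_set/tbE.
    rewrite -real_normK ?num_real// -[leRHS](sqr_sqrtr e0).
    by rewrite lerXn2r ?nnegrE ?sqrtr_ge0.
  by case: ifP => // _; rewrite /= -tE; have [_ ->] := PE s.
rewrite -integral_mkcond; apply: integral_deriv_poly.
- exact: sqrtr_ge0.
- have [<- _] := PE r; rewrite tE; apply: u0; rewrite big_ord_recl tnth_cons0.
  under eq_bigr do rewrite tnth_consS.
  by rewrite sqr_sqrtr// subrK.
- have [<- _] := PE (- r); rewrite tE; apply: u0;
  rewrite big_ord_recl tnth_cons0.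
  under eq_bigr do rewrite tnth_consS.
  by rewrite sqrrN sqr_sqrtr// subrK.
Qed.

End divergence.

(** * Polar coordinates *)

Section polar.
Variable R : realType.
Variable d : nat.
Local Notation leb := (@lebesgue_measure R).
Local Notation mu := (lebesgue_tuple R d).
Local Notation sigma := (@surface_measure R d).
Implicit Types (x : RR[R]_d) (r a b : R).

(** The origin is left out, as in [solid_cone], since [direction] is not a unit vector there. *)
Definition pball r : set RR[R]_d := [set x | 0 < enorm x <= r].

Lemma enorm_ge0 x : 0 <= enorm x. Proof. exact: sqrtr_ge0. Qed.

Lemma enorm_sqr x : enorm x ^+ 2 = \sum_i tnth x i ^+ 2.
Proof. by rewrite sqr_sqrtr// sumr_ge0// => i _; exact: sqr_ge0. Qed.

Lemma enorm_tscale r x : 0 <= r -> enorm (tscale r x) = r * enorm x.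
Proof.
move=> r0; rewrite /enorm; under eq_bigr do rewrite tnth_mktuple exprMn.
by rewrite -mulr_sumr sqrtrM ?sqr_ge0// sqrtr_sqr ger0_norm.
Qed.

Lemma enorm_direction x : 0 < enorm x -> enorm (direction x) = 1.
Proof.
move=> x0; have -> : direction x = tscale (enorm x)^-1 x.
  by apply: eq_from_tnth => i; rewrite !tnth_mktuple mulrC.
by rewrite enorm_tscale ?invr_ge0 ?enorm_ge0// mulVf// lt0r_neq0.
Qed.

Lemma direction_tscale r x : 0 < r -> direction (tscale r x) = direction x.
Proof.
move=> r0; apply: eq_from_tnth => i; rewrite !tnth_mktuple enorm_tscale ?ltW//.
by rewrite -mulf_div divff ?mul1r// lt0r_neq0.
Qed.

Lemma measurable_pball r : measurable (pball r).
Proof.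
rewrite (_ : pball r = @enorm R d @^-1` `]0, r]%classic); last first.
  by apply/seteqP; split => x /=; rewrite in_itv.
by rewrite -[X in measurable X]setTI; exact: measurable_enorm.
Qed.

Lemma measurable_usphere : measurable (@usphere R d).
Proof.
rewrite (_ : usphere = @enorm R d @^-1` [set 1])//.
by rewrite -[X in measurable X]setTI; exact: measurable_enorm.
Qed.

Lemma pball_lty r : (mu (pball r) < +oo)%E.
Proof.
apply: le_lt_trans (tball_lty d (r ^+ 2)); apply: le_measure.
- by rewrite inE; exact: measurable_pball.
- by rewrite inE; exact: measurable_tball.
- move=> x /= /andP[x0 xr]; rewrite /tball/= -enorm_sqr.
  by rewrite lerXn2r ?nnegrE ?enorm_ge0// (le_trans _ xr)// enorm_ge0.
Qed.

Lemma surface_measure_lty : (sigma usphere < +oo)%E.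
Proof.
rewrite /surface_measure; apply: lte_mul_pinfty; [by rewrite lee_fin|by []|].
apply: le_lt_trans (pball_lty 1); apply: le_measure.
- by rewrite inE; exact: measurable_solid_cone measurable_usphere.
- by rewrite inE; exact: measurable_pball.
- exact: subIsetl.
Qed.

(** On subsets of the sphere, [surface_measure] is [d] times the image of Lebesgue measure under the
    map [phi], which is [direction] on the punctured ball. *)
Lemma ge0_integral_usphere (f : RR[R]_d -> \bar R) :
  measurable_fun setT f -> (forall x, 0 <= f x)%E ->
  (\int[sigma]_(x in usphere) f x =
    d%:R%:E * \int[mu]_(x in pball 1) f (direction x))%E.
Proof.
move=> mf f0; pose k := NngNum (ler0n R d).
have md := @measurable_direction R d.
(* The points outside of the ball are sent to the origin, which is not on the
   sphere. *)
pose phi x : RR[R]_d := tscale (\1_(pball 1) x) (direction x).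
have mphi : measurable_fun setT phi.
  apply/measurable_fun_tnthP => i.
  rewrite (_ : _ \o _ = fun x => \1_(pball 1) x * tnth (direction x) i);
    last first.
    by apply/funext => x /=; rewrite tnth_mktuple.
  apply: measurable_funM; first by apply: measurable_indic;
    exact: measurable_pball.
  exact: measurableT_comp (@measurable_tnth _ (measurableTypeR R) d i) md.
have phi_in x : pball 1 x -> phi x = direction x.
  move=> Bx; rewrite /phi indicE mem_set//; apply: eq_from_tnth => i.
  by rewrite tnth_mktuple mul1r.
have phi_out x : ~ pball 1 x -> enorm (phi x) = 0.
  by move=> Bx; rewrite /phi indicE memNset// enorm_tscale// mul0r.
have phiE A : A `<=` usphere -> phi @^-1` A = solid_cone A.
  move=> Au; apply/seteqP; split => x /=.
    move=> Ax; have Bx : pball 1 x.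
      apply: contrapT => /phi_out H; have := Au _ Ax.
      by rewrite /usphere/= H => /esym/eqP; rewrite oner_eq0.
    by split => //; rewrite /preimage /= -(phi_in x Bx).
  by move=> [Bx Ax]; rewrite phi_in.
pose pm : {measure set RR[R]_d -> \bar R} :=
  measure_function_pushforward__canonical__measure_function_Measure mu mphi.
transitivity (\int[mscale k pm]_(x in usphere) f x)%E.
  apply: eq_measure_integral => A mA Au.
  by rewrite -[RHS]/(d%:R%:E * mu (phi @^-1` A))%E phiE.
have mfS : measurable_fun usphere f by exact: measurable_funTS.
rewrite (ge0_integral_mscale _ measurable_usphere)//; congr (_ * _)%E.
rewrite (ge0_integral_pushforward mphi _ measurable_usphere)//.
have -> : phi @^-1` usphere = pball 1.
  rewrite phiE//; apply/seteqP; split => x; first by case.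
  by move=> Bx; split=> //; case/andP: Bx => x0 _; exact: enorm_direction.
by apply: eq_integral => x /set_mem Bx; rewrite /= phi_in.
Qed.

Lemma ge0_integral_pball r (f : RR[R]_d -> \bar R) : 0 < r ->
  measurable_fun setT f -> (forall x, 0 <= f x)%E ->
  (\int[mu]_(x in pball r) f x =
   (r ^+ d)%:E * \int[mu]_(x in pball 1) f (tscale r x))%E.
Proof.
move=> r0 mf f0; rewrite integral_mkcond (ge0_integral_tscale r0)//;
  last 2 first.
- by apply/(measurable_restrictT _ (measurable_pball r));
  exact: measurable_funTS.
- by move=> x; rewrite patchE; case: ifP.
congr (_ * _)%E; rewrite [RHS]integral_mkcond; apply: eq_integral => x _.
rewrite !patchE; have -> // : (tscale r x \in pball r) = (x \in pball 1).
have E : pball r (tscale r x) = pball 1 x.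
  rewrite /pball/= enorm_tscale ?(ltW r0)// (pmulr_rgt0 _ r0).
  by rewrite -[X in _ <= X]mulr1 (ler_pM2l r0).
by apply/idP/idP => /set_mem H; apply/mem_set; rewrite ?E// -E.
Qed.

Section shell.
Variables (phi : RR[R]_d -> R) (C : R).
Hypothesis mphi : measurable_fun setT phi.
Hypothesis phi_ge0 : forall x, 0 <= phi x.
Hypothesis phi_le : forall x, usphere x -> phi x <= C.

(** The extension of [phi] from the sphere that is homogeneous of degree [k]. *)
Let g k x := enorm x ^+ k * phi (direction x).

Let mg k : measurable_fun setT (g k).
Proof.
apply: measurable_funM; first by apply: measurable_funX;
  exact: measurable_enorm.
exact: measurableT_comp mphi (@measurable_direction R d).
Qed.

Let g_ge0 k x : 0 <= g k x.
Proof. by rewrite mulr_ge0// exprn_ge0// enorm_ge0. Qed.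

Lemma integrable_radial k : mu.-integrable (pball 1)
  (EFin \o (fun x => enorm x ^+ k * phi (direction x))).
Proof.
apply: measurable_bounded_integrable.
- exact: measurable_pball.
- exact: pball_lty.
- exact: measurable_funTS (mg k).
- exists C; split; first exact: num_real.
  move=> y Cy x /andP[x0 x1]; rewrite /= ger0_norm; last exact: (g_ge0 k).
  apply: le_trans (ltW Cy); rewrite -[C]mul1r ler_pM ?exprn_ge0 ?enorm_ge0//.
    by rewrite exprn_ile1// enorm_ge0.
  by apply: phi_le; exact: enorm_direction.
Qed.

Let Psi k := \int[mu]_(x in pball 1) g k x.

Let pball_scale k r : 0 < r -> \int[mu]_(x in pball r) g k x =
  r ^+ (d + k) * Psi k.
Proof.
move=> r0; rewrite /Psi /Rintegral (@ge0_integral_pball r (EFin \o g k))//;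
  last 2 first.
- exact/measurable_EFinP.
- by move=> x; rewrite lee_fin g_ge0.
rewrite (_ : \int[mu]_(x in pball 1) (EFin \o g k) (tscale r x) =
  \int[mu]_(x in pball 1) ((r ^+ k)%:E * (EFin \o g k) x))%E; last first.
  apply: eq_integral => x _;
    rewrite /= /g enorm_tscale ?ltW// direction_tscale//.
  by rewrite exprMn -mulrA EFinM.
have gi := integrable_radial k; rewrite integralZl//;
  last exact: measurable_pball.
have Ifin : (\int[mu]_(x in pball 1) (EFin \o g k) x)%E \is a fin_num.
  exact: (integrable_fin_num (measurable_pball 1) gi).
by rewrite muleA -EFinM fineM// exprD.
Qed.

Let shell_int k r : 0 < r < 1 ->
  \int[mu]_(x in pball 1 `\` pball r) g k x = (1 - r ^+ (d + k)) * Psi k.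
Proof.
move=> /andP[r0 r1].
have rS : pball r `<=` pball 1.
  by move=> x /andP[x0 xr]; apply/andP; split => //;
    rewrite (le_trans xr)// ltW.
have := @Rintegral_setU _ _ _ mu (pball r) (pball 1 `\` pball r) (g k).
rewrite setDUK// => H; rewrite mulrBl mul1r -(pball_scale _ r0) /Psi.
rewrite H//; first by rewrite addrC addKr.
- exact: measurable_pball.
- by apply: measurableD; exact: measurable_pball.
- exact: integrable_radial.
- by apply/disj_setPS => x [? []].
Qed.

(* On the shell [r < |x| <= 1], [|x| ^+ k] is between [r ^+ k] and 1. *)
Lemma shell_le k r : 0 < r < 1 ->
  r ^+ k * ((1 - r ^+ d) * Psi 0) <= (1 - r ^+ (d + k)) * Psi k <=
    (1 - r ^+ d) * Psi 0.
Proof.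
move=> r01.
have -> : (1 - r ^+ d) * Psi 0 = \int[mu]_(x in pball 1 `\` pball r) g 0 x.
  by rewrite shell_int ?addn0.
rewrite -shell_int//.
have mS : measurable (pball 1 `\` pball r).
  by apply: measurableD; exact: measurable_pball.
have Si j : mu.-integrable (pball 1 `\` pball r) (EFin \o g j).
  by apply: integrableS (integrable_radial j) => //; exact: measurable_pball.
apply/andP; split.
  rewrite -RintegralZl//; apply: le_Rintegral => //.
    exact: integrable_scale.
  move=> x [/andP[x0 x1] xr]; rewrite /g expr0 mul1r ler_wpM2r//.
  rewrite lerXn2r ?nnegrE ?enorm_ge0//; first by case/andP: r01 => /ltW.
  by rewrite leNgt; apply/negP => xr'; apply: xr; apply/andP; split => //;
    exact: ltW.
apply: le_Rintegral => // x [/andP[x0 x1] xr].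
by rewrite /g expr0 ler_wpM2r// exprn_ile1// enorm_ge0.
Qed.

(* Divide [shell_le] by [1 - r] and let [r] tend to 1. *)
Lemma integral_radial k : d%:R * Psi 0 = (d + k)%:R * Psi k.
Proof.
(* The quotient of [1 - r ^+ m] by [1 - r] as a polynomial; its value [m] at 1 produces the factors
   [d] and [d + k]. *)
pose P m : {poly R} := \sum_(i < m) 'X^i.
have PE m r : (1 - r) * (P m).[r] = 1 - r ^+ m.
  rewrite horner_sum; under eq_bigr do rewrite hornerXn.
  by rewrite -[1 - r]opprB -[RHS]opprB subrX1 mulNr.
have P1 m : (P m).[1] = m%:R.
  rewrite horner_sum; under eq_bigr do rewrite hornerXn expr1n.
  by rewrite sumr_const card_ord.
have le1 (Q : {poly R}) : (forall r, 0 < r < 1 -> 0 <= (1 - r) * Q.[r]) ->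
  0 <= Q.[1].
  move=> H; have cv : Q.[r] @[r --> 1^'-] --> Q.[1].
    by apply: cvg_at_left_filter; exact: continuous_horner.
  apply: (cvgr_to_ge cv).
  near=> r; have r1 : r < 1 by near: r; exact: nbhs_left_lt.
  have r0 : 0 < r by near: r; exact: nbhs_left_gt.
  by have := H r; rewrite r0 r1 pmulr_rge0 ?subr_gt0//; apply.
apply/eqP; rewrite eq_le; apply/andP; split.
  have := le1 (Psi k *: P (d + k)%N - Psi 0 *: ('X^k * P d)).
  rewrite hornerD hornerN !hornerZ hornerM hornerXn !P1 expr1n mul1r subr_ge0.
  rewrite (mulrC (Psi 0)) (mulrC (Psi k)); apply => r r01.
  have /andP[+ _] := shell_le k r01; rewrite -subr_ge0 -!PE.
  by rewrite hornerD hornerN !hornerZ hornerM hornerXn; congr (_ <= _); ring.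
have := le1 (Psi 0 *: P d - Psi k *: P (d + k)%N).
rewrite hornerD hornerN !hornerZ !P1 subr_ge0.
rewrite (mulrC (Psi 0)) (mulrC (Psi k)); apply => r r01.
have /andP[_] := shell_le k r01; rewrite -subr_ge0 -!PE.
by rewrite hornerD hornerN !hornerZ; congr (_ <= _); ring.
Unshelve. all: by end_near. Qed.

End shell.

End polar.

(** * Orthogonality of spherical harmonics *)

Section poly_line.
Variables (R : realType) (d : nat) (i : 'I_d) (x : RR[R]_d).
Implicit Types f g : mpoly d R.

(** The restriction of [f] to the line through [x] in direction [i], as a univariate polynomial. *)
Let line f : {poly R} :=
  mmap polyC (fun j => if j == i then 'X else (tnth x j)%:P) f.

Let horner_line f s : (line f).[s] = meval (tnth (tupd i x s)) f.
Proof.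
rewrite /line /meval /mmap horner_sum; apply: eq_bigr => m _.
rewrite hornerM hornerC; congr (_ * _); rewrite /mmap1 horner_prod.
apply: eq_bigr => j _; rewrite horner_exp tnth_mktuple.
by case: eqVneq => _; rewrite !hornerE.
Qed.

Let deriv_line f : (line f)^`() = line (mderiv i f).
Proof.
(* Both sides obey the Leibniz rule, so the claim reduces to constants and single variables. *)
pose good f := (line f)^`() = line (mderiv i f).
have goodM g h : good g -> good h -> good (g * h).
  move=> gg gh; rewrite /good mderivM /line rmorphM derivM.
  by rewrite [LHS]/= -/(line g) -/(line h) gg gh rmorphD !rmorphM.
have good1 : good 1 by rewrite /good /line rmorph1 -polyC1 derivC mderivC
  rmorph0.
suff : good f by [].
elim/mpolyind: f => [|c m p _ _ IH]; first by rewrite /good /line !raddf0.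
rewrite /good /line mderivD mderivZ !mmapD !mmapZ derivD derivM derivC.
rewrite mul0r add0r; congr (_ * _ + _); last exact: IH.
suff : good (mpolyX R m) by [].
rewrite mpolyXE_id; apply: (big_ind good) => // j _.
elim: (m j) => [|k IHk]; first by rewrite expr0.
rewrite exprS; apply: goodM => //.
rewrite /good /line mmapX mmap1U mderivX mnm1E mmapZ mmapX.
case: eqVneq => [->|ji]; last by rewrite derivC mul0r.
rewrite mul1r derivX (_ : mnm_sub _ _ = mnm0) ?mmap11//.
by apply/mnmP => k'; rewrite mnmBE subnn mnm0E.
Qed.

Lemma meval_line f : exists P : {poly R}, forall s,
  meval (tnth (tupd i x s)) f = P.[s] /\
  meval (tnth (tupd i x s)) (mderiv i f) = P^`().[s].
Proof.
by exists (line f) => s; rewrite deriv_line !horner_line.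
Qed.

End poly_line.

Section poly_eval.
Variables (R : realType) (d : nat).
Implicit Types (f g : mpoly d R) (x : RR[R]_d).

Lemma measurable_meval f : measurable_fun setT (fun x :
  RR[R]_d => meval (tnth x) f).
Proof.
rewrite (_ : (fun x => _) = fun x : RR[R]_d =>
  \sum_(m <- msupp f) mcoeff m f * \prod_(i < d) tnth x i ^+ m i); last first.
  by apply/funext => x; rewrite mevalE.
apply: measurable_sum => m; apply: measurable_funM => //.
apply: measurable_prod => i _; apply: measurable_funX; exact: measurable_tnth.
Qed.

(** A crude bound on the unit ball, sufficient for integrability over balls and spheres of finite
    measure. *)
Definition coef_norm f : R := \sum_(m <- msupp f) `|mcoeff m f|.

Lemma meval_le_coef_norm f x : tball 1 x -> `|meval (tnth x) f| <= coef_norm f.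
Proof.
move=> x1; rewrite mevalE; apply: (le_trans (ler_norm_sum _ _ _)).
apply: ler_sum => m _; rewrite normrM -[leRHS]mulr1 ler_wpM2l// normr_prod.
apply: prodr_ile1 => i _; rewrite normr_ge0 normrX exprn_ile1//.
rewrite -(@ler_sqr _ _ 1) ?nnegrE// expr1n real_normK ?num_real//.
apply: le_trans x1; rewrite (bigD1 i)//= lerDl.
by apply: sumr_ge0 => j _; exact: sqr_ge0.
Qed.

Lemma meval_tscale f k r x : f \is homog k ->
  meval (tnth (tscale r x)) f = r ^+ k * meval (tnth x) f.
Proof.
move=> /dhomogP fk; rewrite !mevalE mulr_sumr; apply: eq_big_seq => m /fk /= <-.
rewrite mulrCA; congr (_ * _); rewrite mdegE expr_sum -big_split/=.
by apply: eq_bigr => i _; rewrite tnth_mktuple exprMn.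
Qed.

Lemma meval_sqnorm x : meval (tnth x) (sqnorm R d) = \sum_i tnth x i ^+ 2.
Proof.
by rewrite /sqnorm rmorph_sum; apply: eq_bigr => i _;
  rewrite rmorphXn /= mevalXU.
Qed.

End poly_eval.

(** * Integrals of homogeneous polynomials over the sphere and the ball *)

Section sphere_integral.
Variables (R : realType) (d : nat).
Local Notation mu := (lebesgue_tuple R d).
Local Notation sigma := (@surface_measure R d).
Implicit Types (f g : mpoly d R) (x : RR[R]_d).

Definition sphere_int f : R := \int[sigma]_(x in usphere) meval (tnth x) f.
Definition ball_int f : R := \int[mu]_(x in pball 1) meval (tnth x) f.

Lemma usphere_tball : @usphere R d `<=` tball 1.
Proof.
by move=> x x1; rewrite -[tball 1 x]/(is_true (_ <= _)) -enorm_sqr x1 expr1n.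
Qed.

Lemma pball_tball : @pball R d 1 `<=` tball 1.
Proof.
move=> x /andP[x0 x1]; rewrite -[tball 1 x]/(is_true (_ <= _)) -enorm_sqr.
by rewrite exprn_ile1// ltW.
Qed.

Lemma sphere_integrable (h : RR[R]_d -> R) C : measurable_fun setT h ->
  (forall x, tball 1 x -> `|h x| <= C) -> sigma.-integrable usphere (EFin \o h).
Proof.
move=> mh hC; apply: measurable_bounded_integrable.
- exact: measurable_usphere.
- exact: surface_measure_lty.
- exact: measurable_funTS.
- exists C; split; first exact: num_real.
  by move=> y Cy x /usphere_tball /hC /le_trans; apply; exact: ltW.
Qed.

Lemma ball_integrable (h : RR[R]_d -> R) C : measurable_fun setT h ->
  (forall x, tball 1 x -> `|h x| <= C) -> mu.-integrable (pball 1) (EFin \o h).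
Proof.
move=> mh hC; apply: integrableS (integrable_tball mh hC).
- exact: measurable_tball.
- exact: measurable_pball.
- exact: pball_tball.
Qed.

Lemma sphere_int_add f g : sphere_int (f + g) = sphere_int f + sphere_int g.
Proof.
rewrite /sphere_int; under eq_Rintegral do rewrite mevalD.
by rewrite RintegralD//; first exact: measurable_usphere;
  apply: (sphere_integrable (measurable_meval _) (@meval_le_coef_norm _ _ _)).
Qed.

Lemma sphere_intZ c f : sphere_int (c *: f) = c * sphere_int f.
Proof.
rewrite /sphere_int; under eq_Rintegral do rewrite mevalZ.
rewrite RintegralZl//; first exact: measurable_usphere.
exact: (sphere_integrable (measurable_meval _) (@meval_le_coef_norm _ _ _)).
Qed.

Lemma sphere_int_sum (I : Type) (r : seq I) (P : pred I) (F : I -> mpoly d R) :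
  sphere_int (\sum_(i <- r | P i) F i) = \sum_(i <- r | P i) sphere_int (F i).
Proof.
apply: big_morph; first exact: sphere_int_add.
by rewrite -(scale0r 0) sphere_intZ mul0r.
Qed.

Lemma sphere_int_sqnormM f : sphere_int (sqnorm R d * f) = sphere_int f.
Proof.
apply: eq_Rintegral => x /set_mem x1.
by rewrite mevalM meval_sqnorm -enorm_sqr x1 expr1n mul1r.
Qed.

Lemma usphere_pball_integral (phi : RR[R]_d -> R) C k :
  measurable_fun setT phi ->
  (forall x, 0 <= phi x) -> (forall x, usphere x -> phi x <= C) ->
  \int[sigma]_(x in usphere) phi x =
  (d + k)%:R * \int[mu]_(x in pball 1) (enorm x ^+ k * phi (direction x)).
Proof.
move=> mphi phi0 phiC; rewrite -(integral_radial mphi phi0 phiC).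
under [X in _ * X]eq_Rintegral do rewrite expr0 mul1r.
have m1 : measurable_fun setT (EFin \o phi) by exact/measurable_EFinP.
have p1 x : (0 <= (EFin \o phi) x)%E by rewrite lee_fin.
rewrite {1}/Rintegral (ge0_integral_usphere m1 p1) fineM//.
apply: integrable_fin_num; first exact: measurable_pball.
apply: eq_integrable (integrable_radial mphi phi0 phiC 0);
  first exact: measurable_pball.
by move=> x _; rewrite /= expr0 mul1r.
Qed.

(** The polar formula is available for nonnegative functions, whereas [f] may change sign: apply it
    to [f + C] and to the constant [C], then subtract. *)
Lemma sphere_int_homog f k : f \is homog k -> sphere_int f =
  (d + k)%:R * ball_int f.
Proof.
move=> fk; pose C := coef_norm f.
have C0 : 0 <= C by apply: sumr_ge0.
have mf := measurable_meval f.
have fC := @meval_le_coef_norm _ _ f.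
(* The absolute value ensures nonnegativity everywhere; on the sphere, where [C] bounds [f], it
   changes nothing. *)
pose phi x := `|meval (tnth x) f + C|.
have mphi : measurable_fun setT phi.
  by apply: measurableT_comp => //; exact: measurable_funD.
have phiE x : usphere x -> phi x = meval (tnth x) f + C.
  move=> /usphere_tball /fC; rewrite ler_norml => /andP[H _].
  by rewrite /phi ger0_norm//; move: H; rewrite -/C; lra.
have phiC x : usphere x -> phi x <= C + C.
  by move=> xS; rewrite phiE// lerD2r; have := fC _ (usphere_tball xS);
    rewrite ler_norml => /andP[].
have := usphere_pball_integral k mphi (fun x => normr_ge0 _) phiC.
have := @usphere_pball_integral (fun=> C) C k (measurable_cst _) (fun=> C0)
  (fun _ _ => lexx _).
have iC : sigma.-integrable usphere (EFin \o (fun=> C)).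
  by apply: (@sphere_integrable _ C) => // x _; rewrite ger0_norm.
have fE x : 0 < enorm x -> meval (tnth x) f =
  enorm x ^+ k * meval (tnth (direction x)) f.
  move=> x0; rewrite -(meval_tscale _ _ fk); apply: meval_eq => i.
  by rewrite !tnth_mktuple mulrC divfK// lt0r_neq0.
have E1 : \int[sigma]_(x in usphere) phi x =
  sphere_int f + \int[sigma]_(x in usphere) C.
  rewrite -RintegralD//; last exact: (sphere_integrable mf fC).
    by apply: eq_Rintegral => x /set_mem/phiE.
  exact: measurable_usphere.
have iCk : mu.-integrable (pball 1) (EFin \o (fun x => enorm x ^+ k * C)).
  apply: (@ball_integrable _ C).
    by apply: measurable_funM => //; apply: measurable_funX;
      exact: measurable_enorm.
  move=> x x1; rewrite normrM !ger0_norm ?exprn_ge0 ?enorm_ge0// ler_piMl//.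
  rewrite exprn_ile1 ?enorm_ge0// -(@ler_sqr _ _ 1) ?nnegrE ?enorm_ge0//.
  by rewrite enorm_sqr expr1n.
have E2 : \int[mu]_(x in pball 1) (enorm x ^+ k * phi (direction x)) =
    ball_int f + \int[mu]_(x in pball 1) (enorm x ^+ k * C).
  rewrite -RintegralD//; last exact: (ball_integrable mf fC).
    apply: eq_Rintegral => x /set_mem /andP[x0 _].
    by rewrite phiE; [rewrite mulrDr -fE | exact: enorm_direction].
  exact: measurable_pball.
rewrite E1 E2 => -> /eqP; rewrite mulrDr (inj_eq (addIr _)) => /eqP //.
Qed.

End sphere_integral.

Section harmonic_orthogonality.
Variables (R : realType) (d : nat).
Hypothesis d_gt0 : (0 < d)%N.
Local Notation mu := (lebesgue_tuple R d).
Implicit Types (f g : mpoly d R) (x : RR[R]_d).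

Lemma tball_setD_origin : tball 1 `\` tcube 0 = @pball R d 1.
Proof.
apply/seteqP; split => x.
  move=> [x1 x0]; rewrite -[tball 1 x]/(is_true (_ <= _)) -enorm_sqr in x1.
  apply/andP; split; last first.
    move: x1; rewrite -[1 in X in X -> _](expr1n _ 2).
    by rewrite ler_sqr ?nnegrE ?enorm_ge0.
  rewrite lt_neqAle enorm_ge0 andbT eq_sym; apply/eqP => E; apply: x0 => i.
  have : tnth x i ^+ 2 <= 0.
    have <- : enorm x ^+ 2 = 0 by rewrite E expr0n.
    rewrite enorm_sqr (bigD1 i)//= lerDl.
    by apply: sumr_ge0 => j _; exact: sqr_ge0.
  by rewrite normr_le0 -sqrf_eq0 eq_le sqr_ge0 andbT.
move=> Bx; split; first exact: pball_tball.
move=> x0; case/andP: Bx;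
  rewrite lt_neqAle enorm_ge0 andbT eq_sym => /eqP + _; apply.
rewrite /enorm big1 ?sqrtr0// => i _; have := x0 i.
by rewrite normr_le0 => /eqP ->; rewrite expr0n.
Qed.

(** The divergence theorem concerns the closed ball, polar coordinates the punctured one; they
    differ by the origin, a null set since [d > 0]. *)
Lemma ball_int_tball f : \int[mu]_(x in tball 1) meval (tnth x) f = ball_int f.
Proof.
rewrite /ball_int -tball_setD_origin; congr fine; apply: negligible_integral.
- exact: measurable_tcube.
- exact: measurable_tball.
- exact: integrable_tball (measurable_meval f) (@meval_le_coef_norm _ _ f).
- by case: d d_gt0 => // d' _; exact: tcube0.
Qed.

Lemma ball_int_add f g : ball_int (f + g) = ball_int f + ball_int g.
Proof.
rewrite /ball_int; under eq_Rintegral do rewrite mevalD.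
by rewrite RintegralD//; first exact: measurable_pball;
  apply: (ball_integrable (measurable_meval _) (@meval_le_coef_norm _ _ _)).
Qed.

Lemma ball_intZ c f : ball_int (c *: f) = c * ball_int f.
Proof.
rewrite /ball_int; under eq_Rintegral do rewrite mevalZ.
rewrite RintegralZl//; first exact: measurable_pball.
exact: (ball_integrable (measurable_meval _) (@meval_le_coef_norm _ _ _)).
Qed.

Lemma ball_int_sum (I : Type) (r : seq I) (P : pred I) (F : I -> mpoly d R) :
  ball_int (\sum_(i <- r | P i) F i) = \sum_(i <- r | P i) ball_int (F i).
Proof.
apply: big_morph; first exact: ball_int_add.
by rewrite -(scale0r 0) ball_intZ mul0r.
Qed.

Lemma ball_int_mderiv f i : ball_int (mderiv i (f * (1 - sqnorm R d))) = 0.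
Proof.
rewrite -ball_int_tball /Rintegral.
rewrite (@integral_partial_eq0 _ _ i
  (fun x => meval (tnth x) (f * (1 - sqnorm R d))) _ 1 (coef_norm (mderiv i (f
    * (1 - sqnorm R d)))))//.
- exact: measurable_meval.
- by move=> x; exact: meval_le_coef_norm.
- by move=> x; exact: meval_line.
- by move=> x x1; rewrite mevalM mevalB meval1 meval_sqnorm x1 subrr mulr0.
Qed.

(* Integrating the derivatives of [(1 - |x|^2) mderiv i f], which vanish on the
   sphere, over the ball. *)
Lemma ball_int_laplacian f k : f \is homog k ->
  ball_int (laplacian f) - ball_int (sqnorm R d * laplacian f) =
    (2 * k%:R) * ball_int f.
Proof.
move=> fk; have : ball_int (\sum_(i < d) mderiv i (mderiv i f * (1 - sqnorm R
  d))) = 0.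
  by rewrite ball_int_sum big1// => i _; exact: ball_int_mderiv.
have -> : \sum_(i < d) mderiv i (mderiv i f * (1 - sqnorm R d)) =
    laplacian f + (-1) *: (sqnorm R d * laplacian f) + (- (2 * k%:R)) *: f.
  (* The derivative of [1 - sqnorm] contributes [- 2 x . grad f], which Euler's identity
     evaluates. *)
  have -> : (- (2 * k%:R)) *: f = - (2 *: \sum_(i < d) 'Xv_i * mderiv i f).
    by rewrite (Euler_homog fk) scalerA scaleNr.
  rewrite scaleN1r; move: (sqnorm R d) (@mderiv_sqnorm R d) => q Dq.
  rewrite mulrC /laplacian mulr_suml scaler_sumr -!sumrN -!big_split/=.
  apply: eq_bigr => i _; rewrite mderivM mderivB -mpolyC1 mderivC Dq.
  by rewrite mpolyC1 sub0r !scaler_nat; ring.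
rewrite !ball_int_add !ball_intZ => /eqP;
  rewrite mulN1r mulNr subr_eq0 => /eqP //.
Qed.

(** On the sphere [laplacian f] and [sqnorm * laplacian f] coincide. Both are homogeneous, so both
    of their ball integrals vanish, and [ball_int_laplacian] leaves [2 * k * ball_int f = 0]. *)
Lemma sphere_int_eq0_laplacian f k : (0 < k)%N -> f \is homog k ->
  sphere_int (laplacian f) = 0 -> sphere_int f = 0.
Proof.
move=> k0 fk L0; have lk := laplacian_homog fk.
have nz j : (d + j)%:R != 0 :> R by rewrite pnatr_eq0 addn_eq0 -[d == 0]negbK
  -lt0n d_gt0.
have sk := dhomogM (sqnorm_homog R d) lk.
have B1 : ball_int (laplacian f) = 0.
  by have /eqP := sphere_int_homog lk;
    rewrite L0 eq_sym mulf_eq0 (negPf (nz _)) => /eqP.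
have B2 : ball_int (sqnorm R d * laplacian f) = 0.
  have /eqP := sphere_int_homog sk.
  by rewrite sphere_int_sqnormM L0 eq_sym mulf_eq0 (negPf (nz _)) => /eqP.
have := ball_int_laplacian fk; rewrite B1 B2 subrr => /esym/eqP.
rewrite !mulf_eq0 !pnatr_eq0 (gtn_eqF k0)/= => /eqP B0.
by rewrite (sphere_int_homog fk) B0 mulr0.
Qed.

Lemma mderiv_harmonics f m (i : 'I_d) : harmonics m f ->
  harmonics m.-1 (mderiv i f).
Proof.
move=> [fm lf]; split; first exact: mderiv_homog.
by rewrite laplacian_mderiv lf linear0.
Qed.

(** Induction on the smaller degree [m]: the Laplacian of [f * g] involves only products of first
    derivatives, harmonic of degrees [m.-1] and [m'.-1]. For [m = 0] the derivatives of [f]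
    vanish. *)
Let sphere_int_harmonics_lt m m' f g : harmonics m f -> harmonics m' g ->
  (m < m')%N -> sphere_int (f * g) = 0.
Proof.
elim: m m' f g => [|m IH] m' f g [fm lf] [gm lg] mm'.
all: apply: (sphere_int_eq0_laplacian _ (dhomogM fm gm));
  first by rewrite addn_gt0 (leq_ltn_trans _ mm') ?orbT.
all: rewrite laplacianM lf lg mul0r mulr0 !add0r sphere_intZ sphere_int_sum
  big1 ?mulr0// => i _.
  by rewrite mderiv_homog0// mul0r -(scale0r 0) sphere_intZ mul0r.
apply: (IH m'.-1); [exact: (mderiv_harmonics i (conj fm lf)) | exact:
  mderiv_harmonics|].
by case: m' mm' {gm} => // m'; rewrite ltnS.
Qed.

Lemma sphere_int_harmonics m m' f g : harmonics m f -> harmonics m' g ->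
  m != m' ->
  sphere_int (f * g) = 0.
Proof.
move=> hf hg; rewrite neq_ltn => /orP[mm|mm].
  exact: (sphere_int_harmonics_lt hf hg).
by rewrite mulrC; exact: (sphere_int_harmonics_lt hg hf).
Qed.

End harmonic_orthogonality.

(** * Polynomials on the cone *)

Section cone_poly.
Variables (R : realType) (d : nat).
Implicit Types (f g : mpoly d.+1 R) (Y : mpoly d R) (x xi : RR[R]_d) (t :
  R) (P Q : {poly R}).

Definition tvar : mpoly d.+1 R := mpolyX R (mnm1 ord_max).
(** [P] evaluated at the variable [t], in the form used in [Spoly]. *)
Definition tpoly P : mpoly d.+1 R := (map_poly (@mpolyC d.+1 R) P).[tvar].

Lemma eval_xtM f g x t : eval_xt (f * g) x t = eval_xt f x t * eval_xt g x t.
Proof. exact: mevalM. Qed.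

Lemma tnth_rcons_widen x t (i : 'I_d) :
  tnth [tuple of rcons x t] (widen_ord (leqnSn d) i) = tnth x i.
Proof.
by rewrite !(tnth_nth 0) /= nth_rcons size_tuple ltn_ord.
Qed.

Lemma tnth_rcons_max x t : tnth [tuple of rcons x t] ord_max = t.
Proof. by rewrite (tnth_nth 0) /= nth_rcons size_tuple ltnn eqxx. Qed.

Lemma eval_tvar x t : eval_xt tvar x t = t.
Proof. by rewrite /eval_xt mevalXU tnth_rcons_max. Qed.

Lemma mwidenEsupp Y : mwiden Y =
  \sum_(m <- msupp Y) mcoeff m Y *: mpolyX R (mnmwiden m).
Proof.
rewrite [in LHS](mpolyE Y) (big_morph _ (@mwidenD d R) (@mwiden0 d R)).
by apply: eq_bigr => m _; rewrite mwidenZ mwidenX.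
Qed.

Lemma eval_mwiden Y x t : eval_xt (mwiden Y) x t = meval (tnth x) Y.
Proof.
rewrite /eval_xt mwidenEsupp raddf_sum /= mevalE.
apply: eq_bigr => m _; rewrite mevalZ mevalX big_ord_recr/=.
rewrite mnmwiden_ordmax expr0 mulr1; congr (_ * _); apply: eq_bigr => i _.
by rewrite mnmwiden_widen tnth_rcons_widen.
Qed.

Lemma tpoly_is_additive P Q : tpoly (P + Q) = tpoly P + tpoly Q.
Proof. by rewrite /tpoly rmorphD hornerD. Qed.

Lemma tpolyM P Q : tpoly (P * Q) = tpoly P * tpoly Q.
Proof. by rewrite /tpoly rmorphM hornerM. Qed.

Lemma tpolyXn k : tpoly 'X^k = tvar ^+ k.
Proof. by rewrite /tpoly map_polyXn hornerXn. Qed.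

Lemma tpolyZ c P : tpoly (c *: P) = c *: tpoly P.
Proof. by rewrite /tpoly map_polyZ hornerZ mul_mpolyC. Qed.

Lemma tpoly0 : tpoly 0 = 0.
Proof. by rewrite -(scale0r 0) tpolyZ scale0r. Qed.

Lemma tpoly_sum (I : Type) (r : seq I) (S : pred I) (F : I -> {poly R}) :
  tpoly (\sum_(i <- r | S i) F i) = \sum_(i <- r | S i) tpoly (F i).
Proof. by apply: big_morph; [exact: tpoly_is_additive | exact: tpoly0]. Qed.

Lemma eval_tpoly P x t : eval_xt (tpoly P) x t = P.[t].
Proof.
rewrite -[P in LHS]coefK poly_def tpoly_sum /eval_xt raddf_sum /= horner_coef.
apply: eq_bigr => i _; rewrite tpolyZ tpolyXn mevalZ rmorphXn /=.
by rewrite -[meval _ tvar]/(eval_xt tvar x t) eval_tvar.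
Qed.

Lemma mwiden_homog Y k : Y \is homog k -> mwiden Y \is homog k.
Proof.
move=> /dhomogP Yk; rewrite mwidenEsupp big_seq;
  apply: rpred_sum => m /Yk /= mk.
apply: rpredZ; rewrite dhomogX /= -mk !mdegE big_ord_recr/=.
rewrite mnmwiden_ordmax addn0; apply/eqP/eq_bigr => i _; exact: mnmwiden_widen.
Qed.

Lemma tvarXn_homog k : tvar ^+ k \is homog k.
Proof.
by rewrite -[X in homog X]mul1n; apply: dhomogMn; rewrite dhomogX /= mdeg1.
Qed.

Lemma msize_homog n f k : f \is homog k -> (k <= n)%N ->
  (mmeasure mdeg f <= n.+1)%N.
Proof.
move=> /dhomogP fk kn; rewrite mmeasureE;
  apply/bigmax_leqP_seq => m /fk /= -> _.
by rewrite ltnS.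
Qed.

Lemma msize_tpoly_mwiden P Y k n : (size P + k <= n.+1)%N -> Y \is homog k ->
  (mmeasure mdeg (tpoly P * mwiden Y) <= n.+1)%N.
Proof.
move=> Pn Yk; rewrite -[P]coefK poly_def tpoly_sum mulr_suml.
apply: (leq_trans (mmeasure_sum _ _ _ _)); apply/bigmax_leqP => i _.
apply: (@msize_homog _ _ (i + k)%N); last by have := ltn_ord i; lia.
rewrite tpolyZ tpolyXn -scalerAl; apply: rpredZ; apply: dhomogM.
  exact: tvarXn_homog.
exact: mwiden_homog.
Qed.

End cone_poly.

(** * Reduction of integrals over the cone to one-dimensional moments *)

Section cone_integral.
Variables (R : realType) (d : nat).
Hypothesis d_gt0 : (0 < d)%N.
Implicit Types (f g F : mpoly d.+1 R) (Y : mpoly d R) (x xi : RR[R]_d).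
Implicit Types (t p : R) (P Q : {poly R}).

Definition space_part (m : multinom d.+1) : multinom d :=
  Multinom [tuple m (widen_ord (leqnSn d) i) | i < d].

Lemma mdeg_space_part m : (mdeg (space_part m) + m ord_max)%N = mdeg m.
Proof.
rewrite !mdegE big_ord_recr/=; congr addn; apply: eq_bigr => i _.
exact: mnmE.
Qed.

Lemma mpolyX_space_part m :
  mpolyX R m = tvar R d ^+ m ord_max * mwiden (mpolyX R (space_part m)).
Proof.
rewrite mwidenX /tvar mpolyXn -mpolyXD; congr mpolyX; apply/mnmP => i.
rewrite mnmDE mulmnE mnm1E; case: (unliftP ord_max i) => [j|] ->.
  have -> : lift ord_max j = widen_ord (leqnSn d) j.
    by apply: val_inj; rewrite /= /bump leqNgt ltn_ord.
  rewrite mnmwiden_widen mnmE (_ : (ord_max == _) = false) ?mul0n//.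
  by apply/eqP => /(congr1 val) /= E; have := ltn_ord j; rewrite -E ltnn.
by rewrite eqxx mul1n mnmwiden_ordmax addn0.
Qed.

Lemma mpoly_space_part F : F = \sum_(m <- msupp F) mcoeff m F *:
  (tvar R d ^+ m ord_max * mwiden (mpolyX R (space_part m))).
Proof.
by rewrite [LHS]mpolyE; apply: eq_bigr => m _; rewrite -mpolyX_space_part.
Qed.

Lemma eval_xtZ c F x t : eval_xt (c *: F) x t = c * eval_xt F x t.
Proof. exact: mevalZ. Qed.

Lemma eval_xtD F G x t : eval_xt (F + G) x t = eval_xt F x t + eval_xt G x t.
Proof. exact: mevalD. Qed.

(* [P] gives the integrals of [F] over the sections of the cone by [t] constant,
   parametrised by the sphere. *)
Definition is_radial F P : Prop := forall t,
  surface_measure.-integrable usphere (EFin \o (fun xi => eval_xt F (tscale t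
    xi) t)) /\
  \int[surface_measure]_(xi in usphere) eval_xt F (tscale t xi) t = P.[t].

Lemma is_radial_scale c F P : is_radial F P -> is_radial (c *: F) (c *: P).
Proof.
move=> FP t; have [iF FE] := FP t.
have E : (fun xi => eval_xt (c *: F) (tscale t xi) t) =
    (fun xi => c * eval_xt F (tscale t xi) t).
  by apply/funext => xi; rewrite eval_xtZ.
rewrite E; split; first by apply: integrable_scale => //;
  exact: measurable_usphere.
by rewrite hornerZ -FE RintegralZl//; exact: measurable_usphere.
Qed.

Lemma is_radial_add F G P Q : is_radial F P -> is_radial G Q ->
  is_radial (F + G) (P + Q).
Proof.
move=> FP GQ t; have [iF FE] := FP t; have [iG GE] := GQ t.
have E : (fun xi => eval_xt (F + G) (tscale t xi) t) =
    (fun xi => eval_xt F (tscale t xi) t + eval_xt G (tscale t xi) t).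
  by apply/funext => xi; rewrite eval_xtD.
rewrite E; split; first by apply: integrable_add => //;
  exact: measurable_usphere.
by rewrite hornerD -FE -GE RintegralD//; exact: measurable_usphere.
Qed.

Lemma is_radial_homog P Y k : Y \is homog k ->
  is_radial (tpoly d P * mwiden Y) (sphere_int Y *: ('X^k * P)).
Proof.
move=> Yk t.
have E : (fun xi => eval_xt (tpoly d P * mwiden Y) (tscale t xi) t) =
    (fun xi => (t ^+ k * P.[t]) * meval (tnth xi) Y).
  apply/funext => xi; rewrite eval_xtM eval_tpoly eval_mwiden (meval_tscale _ _
    Yk).
  by rewrite mulrCA mulrA.
have iY := sphere_integrable (measurable_meval Y) (@meval_le_coef_norm _ _ Y).
rewrite E; split; first by apply: integrable_scale => //;
  exact: measurable_usphere.
rewrite RintegralZl//; last exact: measurable_usphere.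
by rewrite hornerZ hornerM hornerXn mulrC.
Qed.

Lemma is_radial0 : is_radial 0 0.
Proof.
have := @is_radial_homog 0 0 0 (rpred0 _).
by rewrite tpoly0 mul0r mulr0 scaler0.
Qed.

(** A monomial of total degree [D] contributes [t ^ D] times the spherical integral of its part in
    [x], whence the bound on the size. *)
Lemma is_radial_exists F :
  exists2 P, is_radial F P & (size P <= mmeasure mdeg F)%N.
Proof.
rewrite mmeasureE {1}(mpoly_space_part F).
elim: (msupp F) => [|m s [P FP Ps]].
  by exists 0; rewrite ?size_poly0// big_nil; exact: is_radial0.
have Xm : mpolyX R (space_part m) \is homog (mdeg (space_part m)) by rewrite
  dhomogX.
rewrite !big_cons -tpolyXn.
exists (mcoeff m F *: (sphere_int (mpolyX R (space_part m)) *: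
   ('X^(mdeg (space_part m)) * 'X^(m ord_max))) + P).
  apply: is_radial_add FP; apply: is_radial_scale; exact: is_radial_homog.
apply: (leq_trans (size_polyD _ _)); rewrite geq_max; apply/andP; split.
  do 2 apply: (leq_trans (size_scale_leq _ _)).
  by rewrite -exprD size_polyXn mdeg_space_part leq_maxl.
by rewrite (leq_trans Ps)// leq_maxr.
Qed.

Definition cone_moment p F : R :=
  cone_integral (fun x t => eval_xt F x t * cone_weight p t).

Lemma cone_ipE p f g : cone_ip p f g =
  (sphere_area R d * Gamma (p - d%:R))^-1 * cone_moment p (f * g).
Proof.
rewrite /cone_ip /cone_moment; congr (_ * cone_integral _).
by apply/funext => x; apply/funext => t; rewrite eval_xtM.
Qed.

(** The power [d.-1] comes from the measure on the cone, and [K + d < p] makes the radial integral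
    converge. *)
Lemma cone_moment_radial p F P (K : nat) : is_radial F P ->
  (size P <= K.+1)%N ->
  K%:R + d%:R < p -> cone_moment p F = wmoment (- p) ('X^(d.-1) * P).
Proof.
move=> FP PK Kp; rewrite /cone_moment /cone_integral.
have sP : (size ('X^(d.-1) * P)%R <= d + K)%N.
  by apply: (leq_trans (size_polyMleq _ _)); rewrite size_polyXn; move: d_gt0;
    lia.
rewrite -(Rintegral_invexp_poly sP); last by rewrite natrD; lra.
pose G t := ('X^(d.-1) * P).[t] * invexp (- p) t.
have E t : t ^+ d.-1 * (\int[surface_measure]_(xi in usphere)
    (eval_xt F [tuple t * tnth xi i | i < d] t * cone_weight p t)) = G t.
  have [iF FE] := FP t; rewrite RintegralZr//; last exact: measurable_usphere.
  rewrite -[\int[_]_(_ in _) _]/(\int[surface_measure]_(xi in usphere) eval_xt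
    F (tscale t xi) t).
  by rewrite FE /G hornerM hornerXn mulrA.
under eq_Rintegral do rewrite E.
(* The cone integral includes the vertex [t = 0], the moment does not; one point is negligible. *)
rewrite /Rintegral; congr fine; rewrite -integral_itv_obnd_cbnd//.
apply/measurable_EFinP; apply: measurable_funM; last exact: measurable_invexp.
apply: measurable_funTS; apply: continuous_measurable_fun;
  exact: continuous_horner.
Qed.

End cone_integral.

(** * Congruence modulo the ideal of the cone *)

Section cone_congruence.
Variables (R : realType) (d : nat).
Implicit Types (f g u v : mpoly d.+1 R) (Y : mpoly d R).

Lemma eq_mod_cone_refl f : eq_mod_cone f f.
Proof. by exists 0; rewrite subrr mul0r. Qed.

Lemma eq_mod_cone_trans f g u : eq_mod_cone f g -> eq_mod_cone g u ->
  eq_mod_cone f u.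
Proof. by move=> [a E] [b E']; exists (a + b);
  rewrite mulrDl -E -E' addrA subrK. Qed.

Lemma eq_mod_cone_add f g u v : eq_mod_cone f g -> eq_mod_cone u v ->
  eq_mod_cone (f + u) (g + v).
Proof. by move=> [a E] [b E']; exists (a + b);
  rewrite mulrDl -E -E' opprD addrACA. Qed.

Lemma eq_mod_cone_scale c f g : eq_mod_cone f g ->
  eq_mod_cone (c *: f) (c *: g).
Proof. by move=> [a E]; exists (c *: a); rewrite -scalerBr E scalerAl. Qed.

Lemma eq_mod_cone_mul u f g : eq_mod_cone f g -> eq_mod_cone (u * f) (u * g).
Proof. by move=> [a E]; exists (u * a); rewrite -mulrBr E mulrA. Qed.

Lemma eq_mod_cone_exp f g k : eq_mod_cone f g -> eq_mod_cone (f ^+ k) (g ^+ k).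
Proof.
move=> fg; elim: k => [|k IH]; first by rewrite !expr0; exact: eq_mod_cone_refl.
rewrite !exprS; apply: (eq_mod_cone_trans (eq_mod_cone_mul f IH)).
by rewrite ![_ * g ^+ k]mulrC; exact: eq_mod_cone_mul.
Qed.

Lemma cone_polyE : cone_poly R d = mwiden (sqnorm R d) - tvar R d ^+ 2.
Proof.
rewrite /cone_poly; congr (_ - _).
rewrite /sqnorm (big_morph _ (@mwidenD d R) (@mwiden0 d R)).
by apply: eq_bigr => i _; rewrite !expr2 mwidenM mwidenX mnmwiden1.
Qed.

Lemma eq_mod_cone_sqnorm : eq_mod_cone (mwiden (sqnorm R d)) (tvar R d ^+ 2).
Proof. by exists 1; rewrite mul1r cone_polyE. Qed.

Lemma eval_xtB f g (x : RR[R]_d) t : eval_xt (f - g) x t =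
  eval_xt f x t - eval_xt g x t.
Proof. exact: mevalB. Qed.

Lemma eval_eq_mod_cone f g (xi : RR[R]_d) (t : R) : usphere xi ->
  eq_mod_cone f g ->
  eval_xt f (tscale t xi) t = eval_xt g (tscale t xi) t.
Proof.
move=> xi1 [u E]; apply/eqP; rewrite -subr_eq0; apply/eqP.
rewrite -eval_xtB E eval_xtM cone_polyE [X in _ * X](_ : _ = 0) ?mulr0//.
rewrite eval_xtB eval_mwiden expr2 eval_xtM eval_tvar.
rewrite meval_sqnorm; under eq_bigr do rewrite tnth_mktuple exprMn.
by rewrite -mulr_sumr -enorm_sqr xi1; ring.
Qed.

(** The inner product depends only on values at the points [(t xi, t)], where [cone_poly]
    vanishes. *)
Lemma cone_ip_eq_mod p f f' g : eq_mod_cone f f' -> cone_ip p f g =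
  cone_ip p f' g.
Proof.
move=> ff'; rewrite /cone_ip /cone_integral.
under eq_Rintegral => t _.
  under eq_Rintegral => xi /set_mem xi1 do rewrite (eval_eq_mod_cone t xi1 ff').
  over.
by [].
Qed.

Lemma cone_ipC p f g : cone_ip p f g = cone_ip p g f.
Proof. by rewrite (cone_ipE p f g) (cone_ipE p g f) (mulrC f g). Qed.

Lemma tpoly_mwiden_sqnorm k s Y : eq_mod_cone
  (tvar R d ^+ k * mwiden (sqnorm R d ^+ s * Y)) (tvar R d ^+ (k + 2 * s) *
    mwiden Y).
Proof.
have E : mwiden (sqnorm R d ^+ s) = mwiden (sqnorm R d) ^+ s.
  by elim: s => [|s IH]; rewrite ?mwiden1// !exprS mwidenM IH.
have := eq_mod_cone_mul (tvar R d ^+ k * mwiden Y)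
  (eq_mod_cone_exp s eq_mod_cone_sqnorm).
have -> : tvar R d ^+ k * mwiden Y * (tvar R d ^+ 2) ^+ s =
  tvar R d ^+ (k + 2 * s) * mwiden Y.
  by rewrite exprD exprM mulrAC.
by rewrite mwidenM E -mulrA [mwiden Y * _]mulrC.
Qed.

Lemma msizeM_leq f g a b : (mmeasure mdeg f <= a.+1)%N ->
  (mmeasure mdeg g <= b.+1)%N ->
  (mmeasure mdeg (f * g) <= (a + b).+1)%N.
Proof.
move=> fa gb; have [->|f0] := eqVneq f 0; first by rewrite mul0r mmeasure0.
have [->|g0] := eqVneq g 0; first by rewrite mulr0 mmeasure0.
by rewrite msizeM//; move: fa gb; set x := mmeasure _ _;
  set y := mmeasure _ _; lia.
Qed.

End cone_congruence.

(** * Completeness of the products of powers of [t] with harmonics *)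

Section cone_span.
Variables (R : realType) (d : nat) (h : nat -> nat) (Y : forall m : nat,
  'I_(h m) -> mpoly d R).
Arguments Y : clear implicits.
Hypothesis d_gt0 : (0 < d)%N.
Hypothesis Y_basis : forall m, is_basis_mod eq (@harmonics R d m) (Y m).

(** Completeness as an induction principle, which serves for orthogonality as well as for spanning.
    A monomial is a power of [t] times a monomial in [x]; the latter is decomposed into harmonics,
    and on the cone the powers of [sqnorm] become powers of [t] of the same degree. *)
Lemma cone_span (V : set (mpoly d.+1 R)) n :
  V 0 -> (forall u v, V u -> V v -> V (u + v)) -> (forall c u, V u ->
    V (c *: u)) ->
  (forall u v, eq_mod_cone u v -> V v -> V u) ->
  (forall k m l, (k + m <= n)%N -> V (tvar R d ^+ k * mwiden (Y m l))) ->
  forall f, (mmeasure mdeg f <= n.+1)%N -> V f.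
Proof.
move=> V0 VD VZ Vmod VY f fn; rewrite (mpoly_space_part f) big_seq.
apply: (big_ind V) => // mon /msize_mdeg_lt mon_f; apply: (VZ).
have monn : (mdeg mon <= n)%N by rewrite -ltnS (leq_trans mon_f).
rewrite -mdeg_space_part in monn.
apply: (@harmonic_decomposition R d
  [set y | V (tvar R d ^+ mon ord_max * mwiden y)] (mdeg (space_part mon))
  _ d_gt0) => /=.
- by rewrite mwiden0 mulr0.
- by move=> u v Vu Vv; rewrite mwidenD mulrDr; exact: VD.
- by move=> c u Vu; rewrite mwidenZ -scalerAr; exact: VZ.
- move=> s a y sa hy; apply: (Vmod _ _ (tpoly_mwiden_sqnorm _ _ _)).
  have [_ _ /(_ _ hy)[c ->]] := Y_basis a.
  rewrite (big_morph _ (@mwidenD d R) (@mwiden0 d R)) mulr_sumr.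
  apply: (big_ind V) => // l _; rewrite mwidenZ -scalerAr; apply/VZ/VY; lia.
- by rewrite dhomogX.
Qed.

End cone_span.

(** * The orthogonal basis *)

Section cone_ip_linear.
Variables (R : realType) (d : nat).
Hypothesis d_gt0 : (0 < d)%N.
Implicit Types (f g F G : mpoly d.+1 R) (p : R).

(** The degree bounds guarantee convergent moments, on which integration is additive. *)
Lemma cone_moment_add p (K : nat) F G : K%:R + d%:R < p ->
  (mmeasure mdeg F <= K.+1)%N -> (mmeasure mdeg G <= K.+1)%N ->
  cone_moment p (F + G) = cone_moment p F + cone_moment p G.
Proof.
move=> Kp FK GK; have [P FP Ps] := is_radial_exists F.
have [Q GQ Qs] := is_radial_exists G.
have PK := leq_trans Ps FK; have QK := leq_trans Qs GK.
have PQK : (size (P + Q)%R <= K.+1)%N.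
  by apply: (leq_trans (size_polyD _ _)); rewrite geq_max PK.
rewrite (cone_moment_radial d_gt0 FP PK Kp) (cone_moment_radial d_gt0 GQ QK Kp).
by rewrite (cone_moment_radial d_gt0 (is_radial_add FP GQ) PQK Kp) mulrDr
  wmomentD.
Qed.

Lemma cone_moment_scale p (K : nat) c F : K%:R + d%:R < p ->
  (mmeasure mdeg F <= K.+1)%N -> cone_moment p (c *: F) = c * cone_moment p F.
Proof.
move=> Kp FK; have [P FP Ps] := is_radial_exists F.
have PK := leq_trans Ps FK.
have cPK : (size (c *: P)%R <=
  K.+1)%N by apply: (leq_trans (size_scale_leq _ _)).
rewrite (cone_moment_radial d_gt0 FP PK Kp).
by rewrite (cone_moment_radial d_gt0 (is_radial_scale c FP) cPK Kp) -scalerAr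
  wmomentZ.
Qed.

(** The weight exponent is shifted by [d.-1] from the measure on the cone and by [m + m'] from the
    homogeneity of [Y] and [Z]. *)
Lemma cone_ip_separable (P Q : {poly R}) (Y Z : mpoly d R) m m' (K : nat) p :
  Y \is homog m -> Z \is homog m' -> (size (P * Q)%R + (m + m') <= K.+1)%N ->
  K%:R + d%:R < p ->
  cone_ip p (tpoly d P * mwiden Y) (tpoly d Q * mwiden Z) =
  (sphere_area R d * Gamma (p - d%:R))^-1 *
    (sphere_int (Y * Z) * wmoment (- p + (d.-1 + (m + m'))%:R) (P * Q)).
Proof.
move=> Ym Zm PQK Kp; rewrite cone_ipE mulrACA -tpolyM -mwidenM.
have FP := is_radial_homog (P * Q) (dhomogM Ym Zm).
have sK : (size (sphere_int (Y * Z) *: ('X^(m + m') * (P * Q)))%R <= K.+1)%N.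
  apply: (leq_trans (size_scale_leq _ _)).
  have [->|PQ0] := eqVneq (P * Q) 0; first by rewrite mulr0 size_poly0.
  by apply: (leq_trans (size_polyMleq _ _)); rewrite size_polyXn; lia.
rewrite (cone_moment_radial d_gt0 FP sK Kp) -scalerAr wmomentZ.
by rewrite !wmomentXnM -addrA -natrD.
Qed.

Variables (p : R) (N : nat).
Hypothesis p_gt : (2 * N + d)%:R < p.
(** Two [small] polynomials have a product of degree at most [2 * N], for which [p_gt] makes the
    inner product converge. *)
Local Notation small f := (mmeasure mdeg f <= N.+1)%N.

Let Kp : (N + N)%:R + d%:R < p.
Proof. by rewrite -natrD addnn -mul2n. Qed.

Lemma cone_ip_add f f' g : small f -> small f' -> small g ->
  cone_ip p (f + f') g = cone_ip p f g + cone_ip p f' g.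
Proof.
move=> fN f'N gN; rewrite (cone_ipE p (f + f') g) (cone_ipE p f g) (cone_ipE p
  f' g) -mulrDr mulrDl.
congr (_ * _).
by apply: (cone_moment_add Kp); exact: msizeM_leq.
Qed.

Lemma cone_ip_scale c f g : small f -> small g ->
  cone_ip p (c *: f) g = c * cone_ip p f g.
Proof.
move=> fN gN; rewrite (cone_ipE p (c *: f) g) (cone_ipE p f g) -(scalerAl c f
  g) [RHS]mulrCA.
congr (_ * _).
by rewrite (cone_moment_scale c Kp)//; exact: msizeM_leq.
Qed.

Lemma cone_ip0 g : small g -> cone_ip p 0 g = 0.
Proof. by move=> gN; rewrite -(scale0r 0) cone_ip_scale ?mul0r// mmeasure0. Qed.

Lemma cone_ip_sum (I : Type) (r : seq I) (S : pred I) (c : I -> R)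
    (F : I -> mpoly d.+1 R) g :
  (forall i, S i -> small (F i)) -> small g ->
  cone_ip p (\sum_(i <- r | S i) c i *: F i) g =
  \sum_(i <- r | S i) c i * cone_ip p (F i) g.
Proof.
move=> FN gN.
suff : small (\sum_(i <- r | S i) c i *: F i) /\
  cone_ip p (\sum_(i <- r | S i) c i *: F i) g =
  \sum_(i <- r | S i) c i * cone_ip p (F i) g by case.
apply: (big_ind2 (fun u v => small u /\ cone_ip p u g = v)).
- by rewrite mmeasure0 cone_ip0.
- move=> u a v b [uN <-] [vN <-]; split; last exact: cone_ip_add.
  by apply: (leq_trans (mmeasureD_le _ _ _)); rewrite geq_max uN.
- move=> i Si; split; last exact: cone_ip_scale (FN i Si) gN.
  exact: leq_trans (mmeasureZ_le _ _ _) (FN i Si).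
Qed.

End cone_ip_linear.

(** * Inner products and span of the polynomials [Spoly] *)

Section Spoly_products.
Variables (R : realType) (d : nat) (h : nat -> nat).
Variables (Y : forall m : nat, 'I_(h m) -> mpoly d R).
Arguments Y : clear implicits.
Hypothesis d_gt0 : (0 < d)%N.
Hypothesis Y_basis : forall m, is_basis_mod eq (@harmonics R d m) (Y m).
Hypothesis Y_orthonormal : forall m (l l' : 'I_(h m)),
  sphere_ip (Y m l) (Y m l') = (l == l')%:R.
Variables (p : R) (N : nat).
Hypothesis p_gt : (2 * N + d)%:R < p.
Local Notation small f := (mmeasure mdeg f <= N.+1)%N.
Local Notation SN k m l := (Spoly p k m (Y m l)).

Let Yh m l : harmonics m (Y m l).
Proof. by have [+ _ _] := Y_basis m; apply. Qed.

Let Yhomog m l : Y m l \is homog m. Proof. by have [] := Yh l. Qed.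

Lemma sphere_int_Y m (l l' : 'I_(h m)) :
  sphere_int (Y m l * Y m l') = sphere_area R d * (l == l')%:R.
Proof.
have ipE (k k' : 'I_(h m)) : sphere_ip (Y m k) (Y m k') =
    (sphere_area R d)^-1 * sphere_int (Y m k * Y m k').
  congr (_ * _); apply: eq_Rintegral => xi _; exact/esym/mevalM.
(* A zero area would have inverse 0 by convention, and [Y m l] would have norm 0 instead of 1. *)
have A0 : sphere_area R d != 0.
  apply/eqP => A0; have := ipE l l; rewrite A0 invr0 mul0r Y_orthonormal eqxx.
  by move/eqP; rewrite oner_eq0.
by rewrite -Y_orthonormal ipE mulVKf.
Qed.

(** The parameter for which the total exponent [- p + (d.-1 + 2 * m)] of the radial weight is
    [- q_ m], the weight of the orthogonality of [Npoly]. *)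
Let q_ (m : nat) : R := p - (2 * m)%:R - d%:R + 1.

Lemma SpolyE k m l : SN k m l = tpoly d (Npoly (k - m) (q_ m)) * mwiden (Y m l).
Proof. by []. Qed.

Let leN (n : nat) : (n <= N)%N -> n%:R <= N%:R :> R.
Proof. by rewrite ler_nat. Qed.

Let pN : 2 * N%:R + d%:R < p. Proof. by rewrite -natrM -natrD. Qed.

Lemma cone_ip_Spoly n n' m m' (l : 'I_(h m)) (l' : 'I_(h m')) :
  (n <= N)%N -> (n' <= N)%N -> (m <= n)%N -> (m' <= n')%N ->
  cone_ip p (SN n m l) (SN n' m' l') =
    (n - m)`!%:R * Gamma (p - n%:R - m%:R - d%:R + 1)
      / ((p - (2 * n)%:R - d%:R) * Gamma (p - d%:R))
    * (n == n')%:R * (m == m')%:R * (l == l' :> nat)%:R.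
Proof.
move=> nN n'N mn mn'; rewrite !SpolyE.
rewrite (cone_ip_separable d_gt0 (K := (N + N)%N) (Yhomog l) (Yhomog l'))//;
  last 2 first.
- apply: (leq_trans (leq_add (size_polyMleq _ _) (leqnn _))).
  by move: (size_Npoly (n - m) (q_ m)) (size_Npoly (n' - m') (q_ m')); lia.
- by rewrite natrD; move: pN; lra.
have [mm|mm] := eqVneq m m'; last first.
  by rewrite (sphere_int_harmonics d_gt0 (Yh l) (Yh l') mm) mul0r !mulr0 mul0r.
case: m' / mm l' mn' => l' mn'; rewrite sphere_int_Y.
have [ll|ll] := eqVneq (l : nat) l'; last first.
  by rewrite (_ : (l == l') = false) ?mulr0 ?mul0r ?mulr0//; exact: negbTE.
rewrite (_ : (l == l') = true) ?mulr1; last exact/eqP/val_inj.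
have -> : - p + (d.-1 + (m + m))%:R = - q_ m.
  by rewrite /q_ -[in RHS](prednK d_gt0) -natr1 addnn mul2n natrD; ring.
have nN' := leN nN.
(* The condition of the moment lemmas for [Npoly (k - m) (q_ m)]; it amounts to [2 * k + d < p]. *)
have k1 k : (k <= N)%N -> (m <= k)%N -> (k - m).*2%:R + 1 < q_ m.
  move=> kN mk; rewrite -addnn natrD natrB// /q_ natrM; move: pN (leN kN); lra.
have [nn|nn] := eqVneq n n'; last first.
  rewrite wmoment_Npoly_neq ?mulr0 ?mul0r//; [exact: k1|exact: k1|].
  by apply/eqP => E; move/eqP: nn; apply; lia.
rewrite -nn wmoment_Npoly_sqr; last exact: k1.
have A0 : sphere_area R d != 0.
  apply/eqP => A0; have := Y_orthonormal l l;
    rewrite /sphere_ip A0 invr0 mul0r eqxx.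
  by move/eqP; rewrite eq_sym oner_eq0.
have G0 : Gamma (p - d%:R) != 0.
  by apply/lt0r_neq0/Gamma_gt0; move: pN (ler0n R N); lra.
have -> : q_ m - (n - m)%:R = p - n%:R - m%:R - d%:R + 1.
  by rewrite /q_ natrB// natrM; ring.
have -> : q_ m - (n - m).*2%:R - 1 = p - (2 * n)%:R - d%:R.
  by rewrite /q_ -addnn natrD natrB// !natrM; ring.
have D0 : p - (2 * n)%:R - d%:R != 0.
  by apply: lt0r_neq0; rewrite natrM; move: pN nN'; lra.
rewrite !mulr1; move: A0 G0 D0;
  move: (sphere_area R d) (Gamma (p - d%:R)) => A G.
move: (p - (2 * n)%:R - d%:R) (Gamma _) => D X A0 G0 D0.
by field; rewrite A0 G0 D0.
Qed.

Lemma msize_Spoly n m (l : 'I_(h m)) : (m <= n)%N ->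
  (mmeasure mdeg (SN n m l) <= n.+1)%N.
Proof.
move=> mn; rewrite SpolyE; apply: msize_tpoly_mwiden (Yhomog l).
by rewrite (leq_trans (leq_add (size_Npoly _ _) (leqnn m)))// addSn subnK.
Qed.

(** By [cone_span] it suffices to test products of a power of [t] with some [Y m' l']. For [m' != m]
    the spherical factor vanishes; for [m' = m] the power of [t] is below [n - m], so the radial
    factor does. *)
Lemma cone_ip_Spoly_lt n m (l : 'I_(h m)) g : (m <= n)%N -> (n <= N)%N ->
  (mmeasure mdeg g <= n)%N -> cone_ip p (SN n m l) g = 0.
Proof.
move=> mn nN gn; have Ssmall : small (SN n m l).
  exact: leq_trans (msize_Spoly l mn) _.
rewrite cone_ipC; case: n => [|n] in mn nN gn Ssmall *.
  have -> : g = 0 by apply/eqP; rewrite -(mmeasure_poly_eq0 mdeg) -leqn0.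
  exact: cone_ip0 p_gt _ Ssmall.
(* Congruence does not preserve degrees, while linearity of [cone_ip] is known for bounded degrees;
   hence a representative of bounded degree is carried along. *)
pose V := [set u : mpoly d.+1 R |
  (exists2 v, eq_mod_cone u v & (mmeasure mdeg v <= n.+1)%N) /\
  cone_ip p u (SN n.+1 m l) = 0].
suff : V g by case.
have small_n (v : mpoly d.+1 R) : (mmeasure mdeg v <= n.+1)%N -> small v.
  by move=> vn; rewrite (leq_trans vn)// ltnW.
apply: (cone_span d_gt0 Y_basis _ _ _ _ _ gn).
- split; last exact: cone_ip0 p_gt _ Ssmall.
  by exists 0; [exact: eq_mod_cone_refl|rewrite mmeasure0].
- move=> u u' [[v uv vn] u0] [[v' uv' vn'] u'0]; split.
    exists (v + v'); first exact: eq_mod_cone_add.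
    by apply: (leq_trans (mmeasureD_le _ _ _)); rewrite geq_max vn.
  rewrite (cone_ip_eq_mod _ _ (eq_mod_cone_add uv uv')).
  rewrite (cone_ip_add d_gt0 p_gt (small_n _ vn) (small_n _ vn') Ssmall).
  by rewrite -(cone_ip_eq_mod _ _ uv) -(cone_ip_eq_mod _ _ uv') u0 u'0 addr0.
- move=> c u [[v uv vn] u0]; split.
    exists (c *: v); first exact: eq_mod_cone_scale.
    exact: leq_trans (mmeasureZ_le _ _ _) vn.
  rewrite (cone_ip_eq_mod _ _ (eq_mod_cone_scale c uv)).
  by rewrite (cone_ip_scale d_gt0 p_gt _ (small_n _ vn) Ssmall)
    -(cone_ip_eq_mod _ _ uv) u0 mulr0.
- move=> u v uv [[w vw wn] v0]; split; first by exists w => //;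
  exact: eq_mod_cone_trans vw.
  by rewrite (cone_ip_eq_mod _ _ uv).
move=> k m' l' kn; split.
  exists (tvar R d ^+ k * mwiden (Y m' l')); first exact: eq_mod_cone_refl.
  by rewrite -tpolyXn; apply: msize_tpoly_mwiden (Yhomog l');
    rewrite size_polyXn.
rewrite SpolyE -tpolyXn (cone_ip_separable d_gt0 (K := (N + N)%N)
  (Yhomog l') (Yhomog l)); last 2 first.
- apply: (leq_trans (leq_add (size_polyMleq _ _) (leqnn _)));
  rewrite size_polyXn.
  by move: (size_Npoly (n.+1 - m) (q_ m)); lia.
- by rewrite natrD; move: pN; lra.
have [mm|mm] := eqVneq m' m; last first.
  by rewrite (sphere_int_harmonics d_gt0 (Yh l') (Yh l) mm) mul0r mulr0.
case: m / mm l mn Ssmall V => l mn _ _.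
have -> : - p + (d.-1 + (m' + m'))%:R = - q_ m'.
  by rewrite /q_ -[in RHS](prednK d_gt0) -natr1 addnn mul2n natrD; ring.
have nN' := leN nN.
rewrite [X in wmoment _ X]mulrC wmoment_Npoly; last 2 first.
- by rewrite -addnn natrD natrB// /q_ natrM; move: pN nN'; lra.
- by rewrite size_polyXn; lia.
rewrite coefXn (_ : (n.+1 - m' == k)%N = false) ?mulr0 ?mul0r ?mulr0//.
by apply/eqP; lia.
Qed.

(* The degrees of the [Npoly i q] are consecutive. *)
Lemma Npoly_span (V : set {poly R}) (q : R) n : n.*2%:R < q ->
  (forall u v, V u -> V v -> V (u + v)) -> (forall c u, V u -> V (c *: u)) ->
  (forall i, (i <= n)%N -> V (Npoly i q)) ->
  forall P : {poly R}, (size P <= n.+1)%N -> V P.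
Proof.
move=> nq VD VZ VN; elim: n => [|n IH] in nq VN *.
  move=> P P1; have c0 := coef_Npoly_gt0 nq.
  have -> : P = (P`_0 / (Npoly 0 q)`_0) *: Npoly 0 q; last exact/VZ/VN.
  apply/polyP => -[|i]; rewrite coefZ; first by rewrite divfK// lt0r_neq0.
  have N1 : (size (Npoly 0 q) <= i.+1)%N by apply: leq_trans (size_Npoly _ _) _.
  by rewrite (nth_default _ N1) nth_default ?mulr0// (leq_trans P1).
move=> P Pn; have c0 := lt0r_neq0 (coef_Npoly_gt0 nq).
pose c := P`_n.+1 / (Npoly n.+1 q)`_n.+1.
rewrite -(subrK (c *: Npoly n.+1 q) P); apply: VD; last exact/VZ/VN.
apply: IH.
- by apply: lt_trans nq; rewrite ltr_nat doubleS.
- by move=> i ni; apply: VN; exact: leqW.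
apply/leq_sizeP => j; rewrite leq_eqVlt => /predU1P[<-|nj].
  by rewrite coefB coefZ /c divfK// subrr.
have Nj : (size (Npoly n.+1 q) <= j)%N by apply: leq_trans (size_Npoly _ _) _.
by rewrite coefB coefZ (nth_default _ Nj) nth_default ?mulr0 ?subrr//
  (leq_trans Pn).
Qed.

(** Refines [cone_span]: for fixed [m], the powers of [t] up to [n - m] are combinations of the
    [Npoly i (q_ m)], and the product of the latter with [Y m l] is the [Spoly] of degree
    [m + i]. *)
Lemma Spoly_span (V : set (mpoly d.+1 R)) n : (n <= N)%N ->
  V 0 -> (forall u v, V u -> V v -> V (u + v)) -> (forall c u, V u ->
    V (c *: u)) ->
  (forall u v, eq_mod_cone u v -> V v -> V u) ->
  (forall k m l, (m <= k)%N -> (k <= n)%N -> V (SN k m l)) ->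
  forall f, (mmeasure mdeg f <= n.+1)%N -> V f.
Proof.
move=> nN V0 VD VZ Vmod VS; apply: (cone_span d_gt0 Y_basis) => // k m l km.
have mn : (m <= n)%N by exact: leq_trans (leq_addl _ _) km.
rewrite -tpolyXn.
apply: (@Npoly_span [set P | V (tpoly d P * mwiden (Y m l))] (q_ m) (n - m)) =>
  /=.
- have nN' := leN nN; rewrite -addnn natrD natrB// /q_ natrM; move: pN; lra.
- by move=> u v Vu Vv; rewrite tpoly_is_additive mulrDl; exact: VD.
- by move=> c u Vu; rewrite tpolyZ -scalerAl; exact: VZ.
- move=> i inm; have := VS (m + i)%N m l; rewrite SpolyE addKn; apply; lia.
- by rewrite size_polyXn; lia.
Qed.

End Spoly_products.

(** * The basis of the orthogonal space *)

Section Spoly_family.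
Variables (R : realType) (d : nat) (h : nat -> nat).
Variables (Y : forall m : nat, 'I_(h m) -> mpoly d R).
Arguments Y : clear implicits.
Hypothesis d_gt0 : (0 < d)%N.
Hypothesis Y_basis : forall m, is_basis_mod eq (@harmonics R d m) (Y m).
Hypothesis Y_orthonormal : forall m (l l' : 'I_(h m)),
  sphere_ip (Y m l) (Y m l') = (l == l')%:R.
Variables (p : R) (n : nat).
Hypothesis p_gt : (2 * n + d)%:R < p.

Local Notation index := {m : 'I_n.+1 & 'I_(h m)}.

(* The pair [(i, j)] stands for the polynomial of degree [j] attached to the
   spherical harmonic [i]; it is only meaningful if [tag i <= j]. *)
Definition Sfam (x : index * 'I_n.+1) : mpoly d.+1 R :=
  Spoly p x.2 (tag x.1) (Y (tag x.1) (tagged x.1)).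

Definition Snorm (x : index * 'I_n.+1) : R :=
  (x.2 - tag x.1)`!%:R * Gamma (p - x.2%:R - (tag x.1)%:R - d%:R + 1)
    / ((p - (2 * x.2)%:R - d%:R) * Gamma (p - d%:R)).

Let valid (x : index * 'I_n.+1) := (tag x.1 <= x.2)%N.

Let pn : 2 * n%:R + d%:R < p. Proof. by rewrite -natrM -natrD. Qed.

Lemma Snorm_neq0 x : valid x -> Snorm x != 0.
Proof.
move=> xv; have x2n : (x.2 : nat)%:R <= n%:R :> R by rewrite ler_nat -ltnS.
have x1n : (tag x.1 : nat)%:R <= n%:R :> R by rewrite ler_nat -ltnS.
apply: lt0r_neq0; rewrite /Snorm divr_gt0// mulr_gt0 ?ltr0n ?fact_gt0//.
- by apply: Gamma_gt0; move: pn; lra.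
- by rewrite natrM; move: pn; lra.
- by apply: Gamma_gt0; move: pn (ler0n R n); lra.
Qed.

Lemma index_eqE (i j : index) :
  ((tag i == tag j :> nat) && (tagged i == tagged j :> nat)) = (i == j).
Proof.
apply/andP/eqP => [|->]; last by rewrite !eqxx.
case: i j => [m l] [m' l'] /= [/eqP mm ll].
have E : m = m' by exact: val_inj.
move=> {mm}; case: m' / E l' ll => l' /eqP ll; congr existT; exact: val_inj.
Qed.

Lemma cone_ip_Sfam x y : valid x -> valid y ->
  cone_ip p (Sfam x) (Sfam y) = Snorm x * (x == y)%:R.
Proof.
move=> xv yv; rewrite /Sfam (cone_ip_Spoly d_gt0 Y_basis Y_orthonormal p_gt)//;
  try by rewrite -ltnS.
rewrite -/(Snorm x); move: (Snorm x) => c;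
  rewrite -!mulrA -!natrM !mulnb index_eqE.
by case: x y {xv yv} => [i j] [i' j']; rewrite xpair_eqE andbC.
Qed.

Lemma msize_Sfam x : valid x -> (mmeasure mdeg (Sfam x) <= n.+1)%N.
Proof.
move=> xv; apply: leq_trans (msize_Spoly Y_basis _ _ xv) _.
by rewrite ltnS -ltnS.
Qed.

Lemma cone_ip_Sfam_sum (c : index * 'I_n.+1 -> R) y : valid y ->
  cone_ip p (\sum_(x | valid x) c x *: Sfam x) (Sfam y) = c y * Snorm y.
Proof.
move=> yv; rewrite (cone_ip_sum d_gt0 p_gt _ _ (fun x => @msize_Sfam x)
  (msize_Sfam yv)).
rewrite (bigD1 y)//= big1 ?addr0 => [|x /andP[xv xy]].
  by rewrite cone_ip_Sfam// eqxx mulr1.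
by rewrite cone_ip_Sfam// (negPf xy) !mulr0.
Qed.

Lemma Sfam_span f : (mmeasure mdeg f <= n.+1)%N ->
  exists c, eq_mod_cone f (\sum_(x | valid x) c x *: Sfam x).
Proof.
apply: (Spoly_span d_gt0 Y_basis p_gt (V := [set f |
  exists c, eq_mod_cone f (\sum_(x | valid x) c x *: Sfam x)]) (leqnn n)) => /=.
- exists (fun=> 0); rewrite big1 => [|x _]; first exact: eq_mod_cone_refl.
  by rewrite scale0r.
- move=> u v [a ua] [b vb]; exists (fun x => a x + b x).
  under eq_bigr do rewrite scalerDl.
  by rewrite big_split; exact: eq_mod_cone_add.
- move=> c u [a ua]; exists (fun x => c * a x).
  under eq_bigr do rewrite -scalerA.
  by rewrite -scaler_sumr; exact: eq_mod_cone_scale.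
- by move=> u v uv [a va]; exists a; exact: eq_mod_cone_trans va.
move=> k m l mk kn.
have mn1 : (m < n.+1)%N by rewrite ltnS (leq_trans mk).
have kn1 : (k < n.+1)%N by [].
pose y : index * 'I_n.+1 :=
  (Tagged (fun m : 'I_n.+1 => 'I_(h m)) (l : 'I_(h (Ordinal mn1))),
    Ordinal kn1).
exists (fun x => (x == y)%:R);
  rewrite (bigD1 y)//= big1 ?addr0 => [|x /andP[_ xy]].
  by rewrite eqxx scale1r; exact: eq_mod_cone_refl.
by rewrite (negPf xy) scale0r.
Qed.

(** Independence follows by pairing with each basis element, whose norm is nonzero. For spanning,
    [f] is expanded in all of [Sfam], and orthogonality to lower degrees kills the coefficients with
    [j < n]. *)
Lemma Spoly_basis : is_basis_mod (@eq_mod_cone R d) (cone_orth_space p n)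
  (fun i : index => Spoly p n (tag i) (Y (tag i) (tagged i))).
Proof.
have valid_max (i : index) : valid (i, ord_max) by rewrite /valid/= -ltnS.
pose top (i : index) := (i, ord_max : 'I_n.+1).
split.
- move=> i; split.
    exists (Sfam (top i)); first exact: eq_mod_cone_refl.
    exact: (msize_Sfam (valid_max i)).
  move=> q qn; apply: (cone_ip_Spoly_lt d_gt0 Y_basis p_gt) => //.
  exact: valid_max.
- move=> c c0 i; apply/eqP.
  have : cone_ip p (\sum_i c i *: Sfam (top i)) (Sfam (top i)) = 0.
    by rewrite (cone_ip_eq_mod _ _ c0) (cone_ip0 d_gt0 p_gt)//;
      exact: (msize_Sfam (valid_max i)).
  rewrite (cone_ip_sum d_gt0 p_gt)//; last 2 first.
  + by move=> j _; exact: (msize_Sfam (valid_max j)).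
  + exact: (msize_Sfam (valid_max i)).
  rewrite (bigD1 i)//= big1 ?addr0 => [|j ji].
    rewrite (cone_ip_Sfam (valid_max i) (valid_max i)) eqxx mulr1 => /eqP.
    by rewrite mulf_eq0 (negPf (Snorm_neq0 (valid_max i))) orbF.
  by rewrite (cone_ip_Sfam (valid_max j) (valid_max i)) xpair_eqE (negPf ji)
    !mulr0.
move=> f [[g fg gn] f_orth].
have [c gc] := Sfam_span gn.
have fc := eq_mod_cone_trans fg gc.
exists (fun i => c (top i)); apply: (eq_mod_cone_trans fc).
rewrite (_ : \sum_(x | valid x) _ = \sum_i c (top i) *: Sfam (top i)).
  exact: eq_mod_cone_refl.
(* The sum over pairs is made iterated, so that for each harmonic the term of top degree can be
   isolated. *)
transitivity (\sum_(x : index * 'I_n.+1 | true && valid (x.1, x.2))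
    c (x.1, x.2) *: Sfam (x.1, x.2)); first by apply: eq_big => -[].
rewrite -(pair_big_dep xpredT (fun i j => valid (i, j)) (fun i j => c (i,
  j) *: Sfam (i, j)))/=.
apply: eq_bigr => i _;
  rewrite (bigD1 ord_max)//= big1 ?addr0// => j /andP[jv jn].
(* As [j] is not maximal, [Sfam (i, j)] has degree less than [n], so [f] is orthogonal to it. *)
have c0 : c (i, j) * Snorm (i, j) = 0.
  rewrite -cone_ip_Sfam_sum// -(cone_ip_eq_mod _ _ fc); apply: f_orth.
  apply: leq_trans (msize_Spoly Y_basis _ _ jv) _ => /=.
  by have := ltn_ord j; rewrite ltnS leq_eqVlt => /predU1P[E|//];
    case/eqP: jn; exact: val_inj.
by move/eqP: c0; rewrite mulf_eq0 (negPf (Snorm_neq0 jv)) orbF => /eqP ->;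
  rewrite scale0r.
Qed.

End Spoly_family.
(* Since [Y m] is a basis of [harmonics m], [h m] is the dimension of the space
   of spherical harmonics of degree [m]. *)
Theorem proposition3p11 (R : realType) (d n n' : nat) (p : R)
    (h : nat -> nat) (Y : forall m : nat, 'I_(h m) -> mpoly d R)
    (d_ge2 : (2 <= d)%N)
    (p_gt : (2 * maxn n n' + d)%:R < p)
    (Y_basis : forall m, is_basis_mod eq (@harmonics R d m) (Y m))
    (Y_orthonormal : forall m (l l' : 'I_(h m)),
       sphere_ip (Y m l) (Y m l') = (l == l')%:R) :
  let SN := fun k m (l : 'I_(h m)) => Spoly p k m (Y m l) in
  let b := fun i : {m : 'I_n.+1 & 'I_(h m)} => SN n (tag i) (tagged i) in
  [/\ is_basis_mod (@eq_mod_cone R d) (cone_orth_space p n) b,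
      forall i j, i != j -> cone_ip p (b i) (b j) = 0 &
      forall (m m' : nat) (l : 'I_(h m)) (l' : 'I_(h m')),
        (m <= n)%N -> (m' <= n')%N ->
        cone_ip p (SN n m l) (SN n' m' l') =
          (n - m)`!%:R * Gamma (p - n%:R - m%:R - d%:R + 1)
            / ((p - (2 * n)%:R - d%:R) * Gamma (p - d%:R))
          * (n == n')%:R * (m == m')%:R * (l == l' :> nat)%:R].
Proof.
move=> SN b; have d_gt0 : (0 < d)%N by exact: ltnW.
have pn : (2 * n + d)%:R < p.
  by apply: le_lt_trans p_gt; rewrite ler_nat leq_add2r leq_mul2l leq_maxl.
split.
- exact: Spoly_basis.
- move=> i j ij; rewrite /b /SN (cone_ip_Spoly d_gt0 Y_basis Y_orthonormal
  pn)//;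
    try by rewrite -ltnS.
  by rewrite -!mulrA -!natrM !mulnb index_eqE (negPf ij) andbF !mulr0.
- move=> m m' l l' mn mn'.
  by apply: (cone_ip_Spoly d_gt0 Y_basis Y_orthonormal p_gt) => //;
    rewrite ?leq_maxl ?leq_maxr.
Qed.
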